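(* Let $n\ge 2$, $d\ge 1$, $l\ge 1$ be integers, and let $\Gamma=\mathbb{Z}/d\mathbb{Z}$, with generator $\xi$, act on $\mathbb{C}[u,v]$ by algebra automorphisms with $\xi(u)=\zeta u$, $\xi(v)=\zeta^{-1}v$, where $\zeta$ is a primitive $d$-th root of unity. Then the Weyl module $W_{\Gamma}(l\omega_1)$ has a quotient which, as a representation of $\mathfrak{sl}_n$, is isomorphic to $\bigwedge^l\big((\mathbb{C}^n)^{\oplus(dl+1)}\big)$.
   Context: $\mathfrak{sl}_n=\mathfrak{sl}_n(\mathbb{C})$ with diagonal Cartan subalgebra $\mathfrak{h}$ and strictly upper triangular matrices $\mathfrak{n}^+$; $\mathfrak{sl}_n(\mathbb{C}[u,v])=\mathfrak{sl}_n\otimes\mathbb{C}[u,v]$. $\omega_1$ is the fundamental weight of $\mathfrak{sl}_n$ which is the highest weight of the natural representation $\mathbb{C}^n$. For a dominant integral weight $\mu\in\mathfrak{h}^*$, $W_\Gamma(\mu)$ is the maximal finite dimensional module over $\mathfrak{sl}_n(\mathbb{C}[u,v])$ generated by a vector $v_\mu$ such that $(\mathfrak{n}^+\otimes\mathbb{C}[u,v])v_\mu=0$ and $(h\otimes P)v_\mu=\mu(h)P(0,0)v_\mu$ for all $h\in\mathfrak{h}$, $P\in\mathbb{C}[u,v]^\Gamma$ (maximal: every finite dimensional module generated by such a vector is a quotient of it). Here $\mathbb{C}[u,v]^\Gamma$ is the ring of $\Gamma$-invariant polynomials.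
   Formalization: The theorem is proved for d ≥ 2 instead of d ≥ 1: for d = 1 the claim is false for all n and l, since the lω_1-weight space of the Weyl module is a line while that of the exterior power has dimension l+1. *)

(* Defs.v *)
(* MathComp, with multinomials for C[u,v] and real-closed for C = R[i]. *)
From HB Require Import structures.
From mathcomp Require Import all_boot all_order all_algebra.
From mathcomp Require Import reals.
From mathcomp Require Import complex mpoly.

Set Implicit Arguments.
Unset Strict Implicit.
Unset Printing Implicit Defensive.

Import GRing.Theory.
Local Open Scope ring_scope.

(* For a commutative K-algebra A, sl_n(A) = sl_n (x) A is the Lie K-algebra   *)
(* of trace-zero matrices over A. A module is given by a map on all of        *)
(* 'M[A]_n of which only the values at trace-zero matrices are meaningful:    *)
(* every notion below quantifies over trace-zero matrices only.               *)
(* sl_n(K) itself is the case A = K^o.                                        *)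
Record sl_module (K : fieldType) (A : comAlgType K) (n : nat) := SlModule {
  slm_sort :> vectType K;
  slm_act : 'M[A]_n -> 'End(slm_sort);
  slm_linear : forall (c : K) (X Y : 'M[A]_n), \tr X = 0 -> \tr Y = 0 ->
    slm_act (c%:A *: X + Y) = c *: slm_act X + slm_act Y;
  slm_bracket : forall X Y : 'M[A]_n, \tr X = 0 -> \tr Y = 0 ->
    slm_act (X *m Y - Y *m X)
    = (slm_act X \o slm_act Y)%VF - (slm_act Y \o slm_act X)%VF
}.
Arguments slm_act {K A n} s _.

Section ModuleTheory.
Variables (K : fieldType) (A : comAlgType K) (n : nat).
Implicit Types V W : sl_module A n.

Definition sl_hom V W (f : 'Hom(V, W)) : Prop :=
  forall X : 'M[A]_n, \tr X = 0 ->
  forall v : V, f (slm_act V X v) = slm_act W X (f v).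

Definition is_quotient_of W V : Prop :=
  exists f : 'Hom(V, W), sl_hom f /\ limg f = fullv.

Definition sl_iso V W : Prop :=
  exists f : 'Hom(V, W), [/\ sl_hom f, lker f = 0%VS & limg f = fullv].

Definition generated_by V (v : V) : Prop :=
  forall U : {vspace V}, v \in U ->
    (forall X : 'M[A]_n, \tr X = 0 -> (slm_act V X @: U <= U)%VS) ->
  U = fullv.

(* g (x) P, for g in sl_n(K) and P in A *)
Definition tens (g : 'M[K]_n) (P : A) : 'M[A]_n := P *: map_mx (in_alg A) g.

End ModuleTheory.

Section Restriction.
Variables (K : fieldType) (A : comAlgType K) (n : nat) (V : sl_module A n).

Definition res_act (g : 'M[K^o]_n) : 'End(V) := slm_act V (tens g 1).

Lemma tr_tens (g : 'M[K]_n) (P : A) : \tr g = 0 -> \tr (tens g P) = 0.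
Proof. by move=> g0; rewrite mxtraceZ trace_map_mx g0 rmorph0 mulr0. Qed.

Fact res_linear (c : K) (X Y : 'M[K^o]_n) : \tr X = 0 -> \tr Y = 0 ->
  res_act (c%:A *: X + Y) = c *: res_act X + res_act Y.
Proof.
move=> X0 Y0; rewrite /res_act -slm_linear ?tr_tens //; congr (slm_act V _).
rewrite /tens !scale1r; apply/matrixP=> i j; rewrite !mxE/=.
have -> : (c%:A : K^o) = c by exact: mulr1.
by rewrite scalerDl mulr_algl scalerA.
Qed.

Fact res_bracket (X Y : 'M[K^o]_n) : \tr X = 0 -> \tr Y = 0 ->
  res_act (X *m Y - Y *m X)
  = (res_act X \o res_act Y)%VF - (res_act Y \o res_act X)%VF.
Proof.
move=> X0 Y0; rewrite /res_act -slm_bracket ?tr_tens //; congr (slm_act V _).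
by rewrite /tens !scale1r map_mxB !map_mxM.
Qed.

Definition res : sl_module K^o n := SlModule res_linear res_bracket.

End Restriction.

Section NaturalRep.
Variables (K : fieldType) (n : nat).

Definition nat_act (X : 'M[K^o]_n) : 'End('cV[K]_n) := linfun (mulmx X).

Fact nat_linear (c : K) (X Y : 'M[K^o]_n) : \tr X = 0 -> \tr Y = 0 ->
  nat_act (c%:A *: X + Y) = c *: nat_act X + nat_act Y.
Proof.
move=> _ _; apply/lfunP=> v.
have -> : (c%:A : K^o) = c by exact: mulr1.
by rewrite !lfunE /= !lfunE /= mulmxDl -scalemxAl !lfunE.
Qed.

Fact nat_bracket (X Y : 'M[K^o]_n) : \tr X = 0 -> \tr Y = 0 ->
  nat_act (X *m Y - Y *m X)
  = (nat_act X \o nat_act Y)%VF - (nat_act Y \o nat_act X)%VF.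
Proof.
move=> _ _; apply/lfunP=> v.
by rewrite !lfunE /= !lfunE /= !lfunE /= !lfunE /= mulmxBl !mulmxA.
Qed.

Definition nat_rep : sl_module K^o n := SlModule nat_linear nat_bracket.

End NaturalRep.

Section DirectSum.
Variables (K : fieldType) (A : comAlgType K) (n : nat) (V : sl_module A n).
Variable N : nat.

Definition dsum_fun (X : 'M[A]_n) (u : {ffun 'I_N -> V}) : {ffun 'I_N -> V} :=
  [ffun j => slm_act V X (u j)].

Fact dsum_fun_linear X : linear (dsum_fun X).
Proof. by move=> c u v; apply/ffunP=> j; rewrite !ffunE linearP. Qed.

HB.instance Definition _ X :=
  GRing.isLinear.Build K {ffun 'I_N -> V} {ffun 'I_N -> V} *:%R (dsum_fun X)
    (dsum_fun_linear X).

Definition dsum_act (X : 'M[A]_n) : 'End({ffun 'I_N -> V}) :=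
  linfun (dsum_fun X).

Fact dsum_linear (c : K) (X Y : 'M[A]_n) : \tr X = 0 -> \tr Y = 0 ->
  dsum_act (c%:A *: X + Y) = c *: dsum_act X + dsum_act Y.
Proof.
move=> X0 Y0; apply/lfunP=> u; rewrite !lfunE /= !lfunE /= !lfunE.
by apply/ffunP=> j; rewrite !ffunE slm_linear // !lfunE /= !lfunE.
Qed.

Fact dsum_bracket (X Y : 'M[A]_n) : \tr X = 0 -> \tr Y = 0 ->
  dsum_act (X *m Y - Y *m X)
  = (dsum_act X \o dsum_act Y)%VF - (dsum_act Y \o dsum_act X)%VF.
Proof.
move=> X0 Y0; apply/lfunP=> u.
rewrite !lfunE /= !lfunE /= !lfunE /= !lfunE /=.
apply/ffunP=> j; rewrite !ffunE slm_bracket //.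
by rewrite !lfunE /= !lfunE /= !lfunE.
Qed.

Definition dsum : sl_module A n := SlModule dsum_linear dsum_bracket.

End DirectSum.

Section ExteriorPower.
Variables (K : fieldType) (l : nat).

Definition upd (U : Type) (u : {ffun 'I_l -> U}) (i : 'I_l) (x : U) :
  {ffun 'I_l -> U} := [ffun k => if k == i then x else u k].

Definition multilinear (U M : vectType K) (f : {ffun 'I_l -> U} -> M) : Prop :=
  forall (u : {ffun 'I_l -> U}) (i : 'I_l) (a : K) (x y : U),
    f (upd u i (a *: x + y)) = a *: f (upd u i x) + f (upd u i y).

Definition alternating (U M : vectType K) (f : {ffun 'I_l -> U} -> M) : Prop :=
  multilinear f /\
  forall (u : {ffun 'I_l -> U}) (i j : 'I_l), i != j -> u i = u j -> f u = 0.

(* (L, w) is the l-th exterior power of U, with w (u_1, ..., u_l) standing    *)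
(* for u_1 /\ ... /\ u_l: the universal alternating l-linear map on U.        *)
Definition exterior_power (U L : vectType K) (w : {ffun 'I_l -> U} -> L) :
  Prop :=
  alternating w /\
  forall (M : vectType K) (f : {ffun 'I_l -> U} -> M), alternating f ->
    exists! h : 'Hom(L, M), forall u, h (w u) = f u.

(* L is the l-th exterior power of V, where X acts on a wedge product by      *)
(* X (u_1 /\ ... /\ u_l) = \sum_i u_1 /\ ... /\ X u_i /\ ... /\ u_l           *)
Definition exterior_rep (A : comAlgType K) (n : nat) (V L : sl_module A n) :
  Prop :=
  exists w : {ffun 'I_l -> V} -> L,
    exterior_power w /\
    forall X : 'M[A]_n, \tr X = 0 -> forall u : {ffun 'I_l -> V},
      slm_act L X (w u) = \sum_(i < l) w (upd u i (slm_act V X (u i))).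

End ExteriorPower.

Section WeylModules.
Variables (K : fieldType) (n : nat).

(* Functionals on the diagonal Cartan subalgebra are given by maps on 'M[K]_n *)
(* of which only the values at diagonal trace-zero matrices are used; the     *)
(* j-th fundamental weight is e_1 + ... + e_j, e_i the i-th diagonal entry.   *)
Definition fund_weight (j : nat) (h : 'M[K]_n) : K :=
  \sum_(i < n | (i < j)%N) h i i.

Local Notation Kuv := {mpoly K[2]}.

(* Gam P means that P lies in the ring of Gamma-invariant polynomials. *)
Definition weyl_generator (Gam : Kuv -> Prop) (mu : 'M[K]_n -> K)
  (V : sl_module Kuv n) (v : V) : Prop :=
  [/\ forall X : 'M[Kuv]_n, (forall i j : 'I_n, (j <= i)%N -> X i j = 0) ->
        slm_act V X v = 0,
      forall (h : 'M[K]_n) (P : Kuv), is_diag_mx h -> \tr h = 0 -> Gam P ->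
        slm_act V (tens h P) v = (mu h * P.@[fun=> 0]) *: v
    & generated_by v].

Definition is_weyl_module (Gam : Kuv -> Prop) (mu : 'M[K]_n -> K)
  (W : sl_module Kuv n) : Prop :=
  (exists w : W, weyl_generator Gam mu w) /\
  forall (V : sl_module Kuv n) (v : V),
    weyl_generator Gam mu v -> is_quotient_of V W.

(* The automorphism xi of K[u,v] with xi u = zeta u and xi v = zeta^-1 v *)
Definition cyc_xi (zeta : K) (P : Kuv) : Kuv :=
  P \mPo [tuple zeta *: 'X_(0 : 'I_2); zeta^-1 *: 'X_(1 : 'I_2)].

(* Pitfall: for zeta = 1 every P is invariant, so the highest weight space of  *)
(* a module with a Weyl generator is a line, whereas that of the l-th exterior *)
(* power of l + 1 copies of K^n has dimension l + 1: the order d of zeta has   *)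
(* to be at least 2 for a quotient of the Weyl module to be the l-th exterior  *)
(* power of dl + 1 copies.                                                     *)
Definition cyc_invariant (zeta : K) (P : Kuv) : Prop :=
  forall k : nat, iter k (cyc_xi zeta) P = P.

End WeylModules.

(* Main.v *)
From HB Require Import structures.
Require Import Defs.
From mathcomp Require Import all_boot all_order all_fingroup all_algebra.
From mathcomp Require Import reals.
From mathcomp Require Import complex mpoly.

(** The Weyl module maps onto every module over sl_n(C[u,v]) with a Weyl
    generator, so one such module has to be found that restricts to the
    exterior power over sl_n.

    Let N = dl + 1 and let C^N have the basis e_0, ..., e_(N-1).  The operators
    x e_i = e_(i+1) and y e_i = c_i e_(i-1) have a diagonal commutator whose
    entries depend on i modulo d only, provided that c_(i+d) = c_i + 1; the
    values c_i of [lowc] also satisfy c_0 = c_N = 0.  Such a commutator is an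
    element of the group algebra of Gamma, of degree 0, so x and y generate a
    deformation of C[u,v]; it acts irreducibly on C^N because c_i is nonzero
    for 0 < i < N.

    Put E = C^n (x) C^N, the direct sum of N copies of C^n.  Matrices with
    entries in the deformation act on the exterior power of E as derivations.
    Let w be the wedge of the l vectors v_1 (x) e_(jd+1), j < l, where v_1 is
    the highest weight vector of C^n.  For d >= 2 the residue class of 1 modulo
    d has exactly l members below N, so a Gamma-invariant polynomial in x and
    y, which preserves their span, multiplies w by a scalar when paired with a
    diagonal matrix.  Filter the exterior power by the degree of the operators
    that are applied to w.  The commutator of x and y has degree 0 instead of 2,
    so u and v act on the associated graded space by commuting operators; and
    an invariant of positive degree kills w there, since it only rescales w and
    thus fails to raise the degree.  Hence w becomes a Weyl generator.

    The filtration is made explicit: its k-th step is spanned by the symmetrised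
    wedges of the vectors z_s(j) e_(jd+1), where z_i = v_(a_i) (x) x^(p_i)
    y^(q_i) and the total degree is less than k.  In this form it is visibly
    stable under the operators with the right shift of degree ([der_fil]), it
    exhausts the exterior power because the monomials in x and y span all maps
    from the span of the e_(jd+1) to C^N ([wfil_full], [fil_full]), and
    polarisation shows that w generates it ([fil_generated]).

    The associated graded module is realised on the exterior power itself.  The
    adjoint of X in sl_n for the standard Hermitian form is the conjugate
    transpose of X, so the orthogonal projections onto the steps of the
    filtration commute with sl_n ([fproj_oact0]).  A matrix with entries of
    degree r is made to act by the part of its operator that raises the graded
    degree by exactly r ([gract_bracket]); constant matrices keep their action
    ([hact_const]), and the restriction to sl_n is still the exterior power. *)

Set Implicit Arguments.
Unset Strict Implicit.
Unset Printing Implicit Defensive.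

Import Order.TTheory GRing.Theory Num.Theory.
Local Open Scope ring_scope.

(** * Multilinear and alternating maps *)

Section Update.
Variables (l : nat) (U : Type).
Implicit Types (u : {ffun 'I_l -> U}) (x : U).

Lemma updE u i x k : upd u i x k = if k == i then x else u k.
Proof. by rewrite ffunE. Qed.

Lemma upd_same u i x : upd u i x i = x.
Proof. by rewrite updE eqxx. Qed.

Lemma upd_other u i x k : k != i -> upd u i x k = u k.
Proof. by rewrite updE => /negPf ->. Qed.

Lemma upd_id u i : upd u i (u i) = u.
Proof. by apply/ffunP=> k; rewrite updE; case: eqP => [->|]. Qed.

Lemma upd_upd u i x y : upd (upd u i x) i y = upd u i y.
Proof. by apply/ffunP=> k; rewrite !updE; case: eqP. Qed.

Lemma updC u i j x y : i != j -> upd (upd u i x) j y = upd (upd u j y) i x.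
Proof.
move=> ij; apply/ffunP=> k; rewrite !updE.
by case: (eqVneq k j) => // ->; rewrite eq_sym (negPf ij).
Qed.

End Update.

Section Multilinear.
Variables (K : fieldType) (l : nat) (U M : vectType K).
Variable f : {ffun 'I_l -> U} -> M.
Hypothesis fM : multilinear f.
Implicit Types u : {ffun 'I_l -> U}.

Lemma multilinear_linear u i : linear (fun x => f (upd u i x)).
Proof. by move=> a x y; apply: fM. Qed.

Definition mlslot u i : {linear U -> M} :=
  HB.pack (fun x => f (upd u i x))
    (GRing.isLinear.Build K U M *:%R (fun x => f (upd u i x))
    (multilinear_linear u i)).

Lemma multilinearD u i x y :
  f (upd u i (x + y)) = f (upd u i x) + f (upd u i y).
Proof. exact: (linearD (mlslot u i)). Qed.

Lemma multilinearZ u i a x : f (upd u i (a *: x)) = a *: f (upd u i x).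
Proof. exact: (linearZZ (mlslot u i)). Qed.

Lemma multilinear_sum u i (I : Type) (r : seq I) (P : pred I) (F : I -> U) :
  f (upd u i (\sum_(s <- r | P s) F s)) = \sum_(s <- r | P s) f (upd u i (F s)).
Proof. exact: (linear_sum (mlslot u i)). Qed.

Lemma multilinear0 u i : u i = 0 -> f u = 0.
Proof.
by move=> ui0; rewrite -(upd_id u i) ui0; apply: (linear0 (mlslot u i)).
Qed.

Lemma multilinear_span u i (X : seq U) (W : {vspace M}) x :
  x \in <<X>>%VS -> {in X, forall y, f (upd u i y) \in W} ->
  f (upd u i x) \in W.
Proof.
move=> /(@coord_span _ _ _ (in_tuple X)) -> fX; rewrite multilinear_sum.
apply: memv_suml => j _; rewrite multilinearZ memvZ // fX //=.
exact: mem_nth.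
Qed.

(** The slots are replaced one at a time by members of the spanning families;
    the auxiliary statement counts the slots that are still arbitrary. *)
Lemma multilinear_mem (X : 'I_l -> seq U) (W : {vspace M}) :
  (forall u, (forall i, u i \in X i) -> f u \in W) ->
  forall u, (forall i, u i \in <<X i>>%VS) -> f u \in W.
Proof.
move=> fX u uX.
suff: forall k (v : {ffun 'I_l -> U}),
  (forall i : 'I_l, if (i < k)%N then v i \in <<X i>>%VS else v i \in X i) ->
  f v \in W.
  by move/(_ l u); apply=> i; rewrite ltn_ord.
elim=> [|k IHk] v vX; first by apply: fX => i; have := vX i.
case: (ltnP k l) => [kl|lk]; last first.
  apply: IHk => i; have := vX i.
  by rewrite !(leq_trans (ltn_ord i)) // (leq_trans lk).
rewrite -(upd_id v (Ordinal kl)).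
apply: (multilinear_span (X := X (Ordinal kl))).
  by have := vX (Ordinal kl); rewrite /= ltnSn.
move=> y yX; apply: IHk => i; rewrite updE.
case: eqP => [->|/eqP ik]; first by rewrite ltnn.
have := vX i; rewrite ltnS leq_eqVlt.
by have /negPf -> /= : (i : nat) != k.
Qed.

End Multilinear.

Lemma multilinear_eq (K : fieldType) (l : nat) (U M : vectType K)
    (f g : {ffun 'I_l -> U} -> M) (X : seq U) :
  multilinear f -> multilinear g -> <<X>>%VS = fullv ->
  (forall u : {ffun 'I_l -> U}, (forall i, u i \in X) -> f u = g u) -> f =1 g.
Proof.
move=> fM gM Xfull fg u; apply/eqP; rewrite -subr_eq0 -memv0.
pose h (u : {ffun 'I_l -> U}) := f u - g u.
apply: (@multilinear_mem _ _ _ _ h _ (fun=> X)).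
- by move=> v i a x y; rewrite /h fM gM scalerBr opprD addrACA.
- by move=> v /fg; rewrite /h => ->; rewrite subrr mem0v.
- by move=> i; rewrite Xfull memvf.
Qed.

Section Alternating.
Variables (K : fieldType) (l : nat) (U M : vectType K).
Variable f : {ffun 'I_l -> U} -> M.
Hypothesis fA : alternating f.
Implicit Types u : {ffun 'I_l -> U}.

(** As usual, from the vanishing of f with u i + u j in both slots i and j. *)
Lemma alternating_tperm u i j : i != j ->
  f [ffun k => u (tperm i j k)] = - f u.
Proof.
case: fA => fM f0 ij.
pose g x y := f (upd (upd u i x) j y).
have gxx x : g x x = 0.
  apply: (f0 _ i j ij); rewrite upd_same upd_other // upd_same //.
have gD x y z : g (x + y) z = g x z + g y z.
  by rewrite /g -!(updC _ _ _ (_ : j != i)) 1?eq_sym // multilinearD.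
have gD' x y z : g z (x + y) = g z x + g z y by rewrite /g multilinearD.
have -> : f u = g (u i) (u j).
  rewrite /g upd_id; congr f.
  apply/ffunP=> k; rewrite !updE; case: (eqVneq k j) => // ->//.
have -> : [ffun k => u (tperm i j k)] = upd (upd u i (u j)) j (u i).
  apply/ffunP=> k; rewrite !ffunE /=.
  case: (eqVneq k j) => [->|kj]; first by rewrite tpermR.
  by case: (eqVneq k i) => [->|ki]; rewrite ?tpermL // tpermD // eq_sym.
have := gxx (u i + u j).
by rewrite gD !gD' !gxx add0r addr0 addrC => /eqP; rewrite addr_eq0 => /eqP.
Qed.

Lemma alternating_perm u (s : 'S_l) : f [ffun k => u (s k)] = (-1) ^+ s *: f u.
Proof.
have [ts -> dts] := prod_tpermP s; elim: ts dts u => [|t ts IHts] /=.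
  move=> _ u; rewrite big_nil odd_perm1 scale1r; congr f.
  by apply/ffunP=> k; rewrite ffunE perm1.
case/andP=> dt dts u; rewrite big_cons odd_permM odd_tperm dt /=.
transitivity (f [ffun k =>
  [ffun m => u ((\prod_(t0 <- ts) tperm t0.1 t0.2)%g m)] (tperm t.1 t.2 k)]).
  by congr f; apply/ffunP=> k; rewrite !ffunE permM.
by rewrite alternating_tperm // IHts // -scaleNr signrN.
Qed.

End Alternating.

(** * The exterior power inside a tensor power *)

(** A basis indexed by a finite type, together with its coordinate forms: the
    index set of the standard basis of a direct sum is a product of two
    ordinals, which a tuple of vectors would have to encode. *)
Record frame (K : fieldType) (U : vectType K) (T : finType) := Frame {
  fvec : T -> U;
  fcoord : U -> T -> K;
  fcoordP : forall a u v t,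
    fcoord (a *: u + v) t = a * fcoord u t + fcoord v t;
  fcoord_vec : forall s t, fcoord (fvec s) t = (s == t)%:R;
  frameE : forall u, u = \sum_t fcoord u t *: fvec t
}.

Section Wedge.
Variables (K : fieldType) (l : nat) (U : vectType K) (T : finType).
Variable B : frame U T.
Implicit Types (u : {ffun 'I_l -> U}) (t : {ffun 'I_l -> T}).

Local Notation Ten := {ffun {ffun 'I_l -> T} -> K^o}.

Definition wedge_mx u t : 'M[K]_l := \matrix_(i, j) fcoord B (u i) (t j).

(** In characteristic 0 the exterior power is the space of antisymmetric
    tensors. A tensor is the array of its coordinates, and the wedge product
    is the array of all maximal minors of the matrix of coordinates. *)
Definition wedge u : Ten := [ffun t => \det (wedge_mx u t)].

Definition bvec t : {ffun 'I_l -> U} := [ffun i => fvec B (t i)].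

Definition ext : {vspace Ten} :=
  <<[seq wedge (bvec t) | t : {ffun 'I_l -> T}]>>%VS.

Lemma wedge_multilinear : multilinear wedge.
Proof.
move=> u i a x y; apply/ffunP=> t; rewrite !ffunE.
rewrite (@determinant_multilinear _ _ _ (wedge_mx (upd u i x) t)
  (wedge_mx (upd u i y) t) i a 1) ?mul1r //.
- by apply/rowP=> j; rewrite !mxE !upd_same fcoordP mul1r.
- by apply/matrixP=> j k; rewrite !mxE !upd_other // eq_sym neq_lift.
- by apply/matrixP=> j k; rewrite !mxE !upd_other // eq_sym neq_lift.
Qed.

Lemma wedge_alternating : alternating wedge.
Proof.
split=> [|u i j ij uij]; first exact: wedge_multilinear.
apply/ffunP=> t; rewrite !ffunE.
by apply: (determinant_alternate ij) => k; rewrite !mxE uij.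
Qed.

Lemma frame_span : <<[seq fvec B t | t : T]>>%VS = fullv.
Proof.
apply/eqP; rewrite eqEsubv subvf /=; apply/subvP=> u _.
rewrite (frameE B u); apply: memv_suml => t _; rewrite memvZ // memv_span //.
exact: image_f.
Qed.

Lemma bvec_mem (P : {ffun 'I_l -> U} -> Prop) :
  (forall t, P (bvec t)) ->
  forall u, (forall i, u i \in [seq fvec B t | t : T]) -> P u.
Proof.
move=> Pb u uB; pose t : {ffun 'I_l -> T} := [ffun i => iinv (uB i)].
by have -> : u = bvec t by apply/ffunP=> i; rewrite !ffunE f_iinv.
Qed.

Lemma wedge_ext u : wedge u \in ext.
Proof.
apply: (multilinear_mem wedge_multilinear
  (X := fun=> [seq fvec B t | t : T])) => [|i]; last by rewrite frame_span memvf.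
apply: bvec_mem => t; rewrite memv_span //; exact: image_f.
Qed.

Lemma ext_ind (W : {vspace Ten}) : (forall u, wedge u \in W) -> (ext <= W)%VS.
Proof. by move=> Ww; apply/span_subvP=> _ /imageP[t _ ->]. Qed.

(** ** The derivation of the tensor power induced by an endomorphism *)

(** The sum over i of g acting on the i-th tensor factor, in coordinates. It
    is defined on all tensors, so that brackets and adjoints can be computed
    there without restriction to antisymmetric tensors. *)
Definition der_fun (g : 'End(U)) (phi : Ten) : Ten :=
  [ffun t : {ffun 'I_l -> T} =>
    \sum_i \sum_s fcoord B (g (fvec B s)) (t i) * phi (upd t i s)].

Fact der_fun_linear g : linear (der_fun g).
Proof.
move=> a p q; apply/ffunP=> t; rewrite !ffunE scaler_sumr -big_split /=.
apply: eq_bigr => i _; rewrite scaler_sumr -big_split /=.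
by apply: eq_bigr => s _; rewrite !ffunE mulrDr mulrCA.
Qed.

HB.instance Definition _ g :=
  GRing.isLinear.Build K Ten Ten *:%R (der_fun g) (der_fun_linear g).

Definition der (g : 'End(U)) : 'End(Ten) := linfun (der_fun g).

Lemma derE g phi t : der g phi t =
  \sum_i \sum_s fcoord B (g (fvec B s)) (t i) * phi (upd t i s).
Proof. by rewrite lfunE /= ffunE. Qed.

Lemma der_linear : linear der.
Proof.
move=> a g h; apply/lfunP=> p; apply/ffunP=> t.
rewrite !lfunE /= lfunE /= !ffunE !lfunE !ffunE scaler_sumr -big_split /=.
apply: eq_bigr => i _; rewrite scaler_sumr -big_split /=.
apply: eq_bigr => s _.
by rewrite lfunE /= lfunE fcoordP mulrDl -mulrA.
Qed.

HB.instance Definition _ :=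
  GRing.isLinear.Build K 'End(U) 'End(Ten) *:%R der der_linear.

Lemma fcoord_sum (t : T) (u : U) (g : 'End(U)) :
  fcoord B (g u) t = \sum_s fcoord B (g (fvec B s)) t * fcoord B u s.
Proof.
pose c (x : U) : K^o := fcoord B x t.
have cl : linear c by move=> a x y; rewrite /c fcoordP.
pose c' : {linear U -> K^o} := HB.pack c (GRing.isLinear.Build K U K^o *:%R c cl).
rewrite -[LHS]/(c' (g u)) {1}(frameE B u) linear_sum linear_sum.
by apply: eq_bigr => s _; rewrite linearZ (linearZZ c') [LHS]mulrC.
Qed.

(** Replacing column i of a matrix A by column i of a matrix A', and summing
    the determinants over i, gives the same as doing so with rows: both sums
    equal the sum of the products of the entries of A' with the cofactors of
    A. Here A' is the matrix of coordinates of the vectors g (u i). *)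
Lemma der_wedge g u : der g (wedge u) = \sum_i wedge (upd u i (g (u i))).
Proof.
apply/ffunP=> t; rewrite derE sum_ffunE.
pose A := wedge_mx u t.
transitivity (\sum_i \sum_k fcoord B (g (u k)) (t i) * cofactor A k i).
  apply: eq_bigr => i _.
  transitivity (\sum_s fcoord B (g (fvec B s)) (t i) *
     \sum_k fcoord B (u k) s * cofactor A k i).
    apply: eq_bigr => s _; rewrite ffunE (expand_det_col _ i).
    congr (_ * _); apply: eq_bigr => k _; rewrite mxE upd_same.
    congr (_ * (_ * \det _)); apply/matrixP=> x y; rewrite !mxE.
    by rewrite upd_other // eq_sym neq_lift.
  under eq_bigr do rewrite mulr_sumr.
  rewrite exchange_big /=; apply: eq_bigr => k _.
  rewrite [in RHS]fcoord_sum mulr_suml.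
  by apply: eq_bigr => s _; rewrite mulrA.
rewrite exchange_big /=; apply: eq_bigr => i _.
rewrite ffunE (expand_det_row _ i); apply: eq_bigr => k _.
rewrite !mxE upd_same; congr (_ * (_ * \det _)).
by apply/matrixP=> x y; rewrite !mxE upd_other // eq_sym neq_lift.
Qed.

(** Operators on different tensor factors commute, so only the terms where
    both endomorphisms act on the same factor survive. *)
Lemma der_comm g h :
  der ((g \o h)%VF - (h \o g)%VF) = (der g \o der h)%VF - (der h \o der g)%VF.
Proof.
pose cross g h phi t := \sum_i \sum_(j | j != i) \sum_s \sum_r
  fcoord B (g (fvec B s)) (t i) * fcoord B (h (fvec B r)) (t j)
  * phi (upd (upd t i s) j r) : K.
have derM g' h' phi t :
    der g' (der h' phi) t = der (g' \o h')%VF phi t + cross g' h' phi t.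
  rewrite !derE -big_split /=; apply: eq_bigr => i _.
  under eq_bigr => s _.
    rewrite derE (bigD1 i) //= mulrDr.
    over.
  rewrite big_split /=; congr (_ + _).
    under eq_bigr do rewrite mulr_sumr.
    rewrite exchange_big /=; apply: eq_bigr => r _.
    rewrite lfunE /= [in RHS]fcoord_sum mulr_suml; apply: eq_bigr => s _.
    by rewrite upd_same upd_upd mulrA.
  rewrite [RHS]exchange_big /=.
  apply: eq_bigr => s _; rewrite mulr_sumr; apply: eq_bigr => j ji.
  rewrite mulr_sumr; apply: eq_bigr => r _.
  by rewrite upd_other // mulrA.
have crossC phi t : cross g h phi t = cross h g phi t.
  rewrite /cross (exchange_big_dep predT) //=; apply: eq_bigr => j _.
  rewrite (eq_bigl (fun i => i != j)); last by move=> i; rewrite eq_sym.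
  apply: eq_bigr => i ij; rewrite exchange_big /=.
  apply: eq_bigr => r _; apply: eq_bigr => s _.
  by rewrite (updC _ _ _ ij) [X in X * _]mulrC.
apply/lfunP=> phi; apply/ffunP=> t.
have subE (p q : 'End(Ten)) : (p - q) phi t = p phi t - q phi t.
  by rewrite add_lfunE opp_lfunE !ffunE.
rewrite linearB [LHS]subE [RHS]subE !comp_lfunE !derM crossC.
by rewrite opprD addrACA subrr addr0.
Qed.

End Wedge.

Arguments der {K l U T} B g.

Section ExtUniv.
Variables (K : numFieldType) (l : nat) (U : vectType K) (T : finType).
Variable B : frame U T.
Local Notation Ten := {ffun {ffun 'I_l -> T} -> K^o}.

Section Lift.
Variables (M : vectType K) (f : {ffun 'I_l -> U} -> M).

(** Summing over all arrays of basis vectors counts every wedge of basis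
    vectors l! times, whence the normalisation. *)
Definition ext_lift_fun (phi : Ten) : M :=
  l`!%:R^-1 *: \sum_t phi t *: f (bvec B t).

Fact ext_lift_linear : linear ext_lift_fun.
Proof.
move=> a p q; rewrite /ext_lift_fun scalerA mulrC -scalerA -scalerDr.
congr (_ *: _); rewrite scaler_sumr -big_split /=; apply: eq_bigr => t _.
by rewrite !ffunE scalerDl scalerA.
Qed.

HB.instance Definition _ :=
  GRing.isLinear.Build K Ten M *:%R ext_lift_fun ext_lift_linear.

Definition ext_lift : 'Hom(Ten, M) := linfun ext_lift_fun.

Lemma wedge_bvec (t0 t : {ffun 'I_l -> T}) :
  wedge B (bvec B t0) t = \sum_(s : 'S_l)
    (-1) ^+ s * (t == [ffun i => t0 ((s^-1)%g i)])%:R.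
Proof.
rewrite ffunE; apply: eq_bigr => s _; congr (_ * _).
under eq_bigr do rewrite mxE ffunE fcoord_vec.
rewrite -natr_prod; congr (_%:R); case: eqP => [->|ne].
  by rewrite big1 // => i _; rewrite ffunE permK eqxx.
have [i ti] : exists i, t0 i != t (s i).
  apply/existsP; rewrite -negb_forall; apply/negP=> /forallP eq_t; case: ne.
  by apply/ffunP=> i; rewrite ffunE (eqP (eq_t _)) permKV.
by rewrite (bigD1 i) //= (negPf ti) mul0n.
Qed.

(** Both sides are multilinear in u, so u may consist of basis vectors; each
    permutation of these then contributes f u, its two signs cancelling. *)
Lemma ext_lift_wedge : alternating f -> forall u, ext_lift (wedge B u) = f u.
Proof.
move=> fA; have fM := fA.1.
apply: (@multilinear_eq _ _ _ _ _ _ [seq fvec B t | t : T]) => //.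
- by move=> u i a x y; rewrite (wedge_multilinear B) linearP.
- exact: frame_span.
apply: bvec_mem => t0; rewrite lfunE /= /ext_lift_fun.
have -> : \sum_t wedge B (bvec B t0) t *: f (bvec B t) =
    \sum_(s : 'S_l) f (bvec B t0).
  under eq_bigr do rewrite wedge_bvec scaler_suml.
  rewrite exchange_big /=; apply: eq_bigr => s _.
  rewrite (bigD1 [ffun i => t0 ((s^-1)%g i)]) //= eqxx mulr1 big1 ?addr0.
    rewrite (_ : bvec B _ = [ffun i => bvec B t0 ((s^-1)%g i)]); last first.
      by apply/ffunP=> i; rewrite !ffunE.
    by rewrite (alternating_perm fA) odd_permV scalerA -signr_addb addbb scale1r.
  by move=> t /negPf ->; rewrite mulr0 scale0r.
rewrite sumr_const card_Sn -[X in _ *: X]scaler_nat scalerA mulVf ?scale1r //.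
by rewrite pnatr_eq0 -lt0n fact_gt0.
Qed.

End Lift.

Definition ext_wedge (u : {ffun 'I_l -> U}) : subvs_of (ext l B) :=
  vsproj (ext l B) (wedge B u).

Lemma vsval_ext_wedge u : vsval (ext_wedge u) = wedge B u.
Proof. by rewrite vsprojK // wedge_ext. Qed.

Lemma ext_wedge_multilinear : multilinear ext_wedge.
Proof. by move=> u i a x y; rewrite /ext_wedge wedge_multilinear linearP. Qed.

Lemma ext_exterior_power : exterior_power ext_wedge.
Proof.
split.
  split; first exact: ext_wedge_multilinear.
  move=> u i j ij uij; rewrite /ext_wedge.
  by rewrite ((wedge_alternating l B).2 _ _ _ ij uij) linear0.
move=> M f fA; pose h : 'Hom(subvs_of (ext l B), M) :=
  (ext_lift f \o linfun vsval)%VF.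
have valE v : linfun vsval v = vsval v :> Ten by rewrite lfunE.
have projE v : linfun (vsproj (ext l B)) v = vsproj _ v by rewrite lfunE.
exists h; split=> [u|h' h'E].
  by rewrite comp_lfunE valE vsval_ext_wedge ext_lift_wedge.
suff hh' phi : phi \in ext l B -> (h - h') (vsproj (ext l B) phi) = 0.
  apply/lfunP=> v; apply/eqP; rewrite -subr_eq0; apply/eqP.
  by rewrite -{1 2}[v]vsvalK -(hh' _ (subvsP v)) add_lfunE opp_lfunE.
have: (ext l B <= lker ((h - h') \o linfun (vsproj (ext l B))))%VS.
  apply: ext_ind => u; rewrite memv_ker comp_lfunE projE.
  rewrite add_lfunE opp_lfunE h'E comp_lfunE valE.
  by rewrite vsval_ext_wedge ext_lift_wedge // subrr.
move=> /subvP sub /sub; rewrite memv_ker comp_lfunE projE.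
by move/eqP.
Qed.

End ExtUniv.

(** * Orthogonal projections *)

Section Hermitian.
Variables (C : numClosedFieldType) (I : finType).
Local Notation V := {ffun I -> C^o}.
Implicit Types (x y z : V) (F G : {vspace V}).

Definition dot x y : C := \sum_i x i * (y i)^*.

Lemma dotC x y : dot y x = (dot x y)^*.
Proof.
rewrite rmorph_sum; apply: eq_bigr => i _ /=.
by rewrite rmorphM /= conjCK mulrC.
Qed.

Lemma dot_linear y : linear (dot^~ y : V -> C^o).
Proof.
move=> a x z; rewrite /dot scaler_sumr -big_split /=.
by apply: eq_bigr => i _; rewrite !ffunE mulrDl -mulrA.
Qed.

Lemma dot_eq0 x : dot x x = 0 -> x = 0.
Proof.
move/eqP; rewrite psumr_eq0 => [/allP x0|i _]; last exact: mul_conjC_ge0.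
apply/ffunP=> i; rewrite ffunE; apply/eqP; rewrite -mul_conjC_eq0.
exact: (x0 i (mem_index_enum i)).
Qed.

Definition dots F x : 'rV[C]_(\dim F) := \row_i dot x (vbasis F)`_i.

Fact dots_linear F : linear (dots F).
Proof. by move=> a x y; apply/rowP=> i; rewrite !mxE dot_linear. Qed.

HB.instance Definition _ F :=
  GRing.isLinear.Build C V 'rV[C]_(\dim F) *:%R (dots F) (dots_linear F).

Definition orthv F : {vspace V} := lker (linfun (dots F)).

Lemma orthvP F x : reflect {in F, forall y, dot x y = 0} (x \in orthv F).
Proof.
rewrite memv_ker lfunE /=; apply: (iffP eqP) => [x0 y yF|x0]; last first.
  by apply/rowP=> i; rewrite !mxE x0 // vbasis_mem // mem_nth // size_tuple.
pose k : {linear V -> C^o} :=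
  HB.pack (dot^~ x : V -> C^o) (GRing.isLinear.Build C V C^o *:%R _ (dot_linear x)).
have ke z : k z = dot z x by [].
rewrite dotC -ke (coord_vbasis yF) linear_sum big1 ?conjC0 // => i _.
rewrite linearZZ ke dotC.
by have /rowP/(_ i) := x0; rewrite !mxE => ->; rewrite conjC0 scaler0.
Qed.

Lemma orthv_cap F : (F :&: orthv F = 0)%VS.
Proof.
apply/eqP; rewrite -subv0; apply/subvP=> x; rewrite memv_cap => /andP[xF].
by move/orthvP/(_ x xF)/dot_eq0 ->; rewrite mem0v.
Qed.

(** The orthogonal complement is the kernel of a map to a space of dimension
    dim F, so its dimension is large enough, and it meets F trivially. *)
Lemma orthv_add F : (F + orthv F = fullv)%VS.
Proof.
apply/eqP; rewrite eqEdim subvf /=.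
rewrite (dimv_disjoint_sum (orthv_cap F)).
rewrite -(limg_ker_dim (linfun (dots F)) fullv) capfv addnC leq_add2r.
by apply: leq_trans (dimvS (subvf _)) _; rewrite dimvf /dim /= mul1n.
Qed.

Definition oproj F : 'End(V) := daddv_pi F (orthv F).

Lemma oproj_mem F x : oproj F x \in F.
Proof. exact: memv_pi. Qed.

Lemma oproj_orth F x : x - oproj F x \in orthv F.
Proof.
have {1}-> : x = daddv_pi F (orthv F) x + daddv_pi (orthv F) F x.
  by rewrite daddv_pi_add ?orthv_cap // orthv_add memvf.
by rewrite addrC addKr memv_pi.
Qed.

Lemma oproj_uniq F x y : y \in F -> x - y \in orthv F -> oproj F x = y.
Proof.
move=> yF xy; apply/eqP; rewrite -subr_eq0 -memv0 -(orthv_cap F) memv_cap.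
rewrite memvB ?oproj_mem //=.
have -> : oproj F x - y = (x - y) - (x - oproj F x).
  by rewrite opprB [RHS]addrC addrA subrK.
by rewrite memvB // oproj_orth.
Qed.

Lemma oproj_id F x : x \in F -> oproj F x = x.
Proof. by move=> xF; apply: oproj_uniq; rewrite ?subrr ?mem0v. Qed.

Lemma oproj_sub F G x : (F <= G)%VS -> oproj F (oproj G x) = oproj F x.
Proof.
move=> FG; apply: oproj_uniq; first exact: oproj_mem.
rewrite (_ : _ - _ = (x - oproj F x) - (x - oproj G x)); last first.
  by rewrite opprB [RHS]addrC addrA subrK.
rewrite memvB ?oproj_orth //.
apply/orthvP=> y yF; apply: (orthvP _ _ (oproj_orth G x)).
exact: (subvP FG).
Qed.

(** f preserves the orthogonal complement of F because its adjoint g preserves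
    F. *)
Lemma oproj_commute (f g : 'End(V)) F :
  (forall x y, dot (f x) y = dot x (g y)) ->
  (forall x, x \in F -> f x \in F) -> (forall x, x \in F -> g x \in F) ->
  forall x, oproj F (f x) = f (oproj F x).
Proof.
move=> adj fF gF x; apply: oproj_uniq; first by rewrite fF ?oproj_mem.
rewrite -linearB; apply/orthvP=> y yF; rewrite adj.
by apply: (orthvP _ _ (oproj_orth F x)); apply: gF.
Qed.

End Hermitian.

(** The derivation sums over a tuple t, a slot i and a new value s of this
    slot; exchanging the old and the new value of slot i transposes the
    kernel. *)
Lemma der_adj (C : numClosedFieldType) (l : nat) (U : vectType C) (T : finType)
    (B : frame U T) (g h : 'End(U)) :
  (forall s t, fcoord B (g (fvec B s)) t = (fcoord B (h (fvec B t)) s)^*) ->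
  forall x y : {ffun {ffun 'I_l -> T} -> C^o},
    dot (der B g x) y = dot x (der B h y).
Proof.
move=> gh x y; rewrite /dot.
under eq_bigr do rewrite derE mulr_suml.
under [RHS]eq_bigr do rewrite derE rmorph_sum mulr_sumr.
rewrite exchange_big [RHS]exchange_big /=; apply: eq_bigr => i _.
under eq_bigr do rewrite mulr_suml.
under [RHS]eq_bigr do rewrite rmorph_sum mulr_sumr.
rewrite !pair_bigA /=.
pose sw (p : {ffun 'I_l -> T} * T) := (upd p.1 i p.2, p.1 i).
have swK : involutive sw.
  by move=> [t s]; rewrite /sw /= upd_upd upd_same upd_id.
rewrite (reindex_inj (inv_inj swK)) /=; apply: eq_bigr => -[t s] _ /=.
rewrite upd_same upd_upd upd_id gh rmorphM /=.
by rewrite [_ * x t]mulrC mulrA.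
Qed.

(** * The associated graded module of a filtered module *)

Section Tens.
Variables (C : fieldType) (n : nat).
Local Notation A := {mpoly C[2]}.
Implicit Types (X Y : 'M[C]_n) (Z : 'M[A]_n).

Lemma tensE X (p : A) i j : tens X p i j = X i j *: p.
Proof. by rewrite !mxE mulr_algr. Qed.

Lemma tens_mul X Y (p q : A) : tens X p *m tens Y q = tens (X *m Y) (p * q).
Proof.
apply/matrixP=> i j; rewrite tensE !mxE scaler_suml; apply: eq_bigr => k _.
by rewrite !tensE -scalerAl -scalerAr scalerA.
Qed.

Lemma tensB X Y (p : A) : tens X p - tens Y p = tens (X - Y) p.
Proof. by apply/matrixP=> i j; rewrite !mxE !mulr_algr scalerBl. Qed.

Lemma tens_decomp Z : exists k, forall D, (k <= D)%N ->
  Z = \sum_(m : 'X_{1..2 < D}) tens (map_mx (mcoeff m) Z) 'X_[m].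
Proof.
exists (\max_i \max_j msize (Z i j))%N => D kD; apply/matrixP=> i j.
rewrite summxE {1}(@mpolywE 2 C D (Z i j)); last first.
  apply: leq_trans kD; apply: leq_trans (leq_bigmax i).
  exact: (leq_bigmax (F := fun j => msize (Z i j)) j).
by apply: eq_bigr => m _; rewrite tensE mxE.
Qed.

(** Reduces identities that are linear in a matrix of polynomials to the case
    of a constant matrix times a monomial. *)
Lemma tens_ind (P : 'M[A]_n -> Prop) :
  P 0 -> (forall Z Z', P Z -> P Z' -> P (Z + Z')) ->
  (forall X m, P (tens X 'X_[m])) -> forall Z, P Z.
Proof.
move=> P0 PD PX Z; have [k Zk] := tens_decomp Z.
by rewrite (Zk _ (leqnn k)); apply: big_ind => // m _; apply: PX.
Qed.

End Tens.

(** O X m stands for the action of X (x) u^p v^q on a filtered space, up to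
    terms of lower degree. F k is the part of degree less than k, so that
    F 0 = 0, and P k is a projection onto F k; the projections are nested. The
    last condition says that O becomes a Lie algebra action on the associated
    graded space. *)
Record filtered_action (C : fieldType) (n : nat) (V : vectType C)
    (O : 'M[C]_n -> 'X_{1..2} -> 'End(V)) (F : nat -> {vspace V})
    (P : nat -> 'End(V)) (D : nat) : Prop := FilteredAction {
  fact_linear : forall m a X Y, O (a *: X + Y) m = a *: O X m + O Y m;
  fact_F0 : F 0 = 0%VS;
  fact_le : forall i j, (i <= j)%N -> (F i <= F j)%VS;
  fact_top : forall k, (D <= k)%N -> F k = F D;
  fact_proj : forall k x, P k x \in F k;
  fact_id : forall k x, x \in F k -> P k x = x;
  fact_comp : forall i j x, (i <= j)%N -> P i (P j x) = P i x;
  fact_deg : forall X m k x, x \in F k -> O X m x \in F (k + mdeg m)%N;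
  fact_comm : forall X Y m m' k x, x \in F k.+1 ->
    O X m (O Y m' x) - O Y m' (O X m x) - O (X *m Y - Y *m X) (m + m')%MM x
    \in F (k + mdeg m + mdeg m')%N
}.

Section Graded.
Variables (C : fieldType) (n : nat) (V : vectType C).
Local Notation A := {mpoly C[2]}.
Variable O : 'M[C]_n -> 'X_{1..2} -> 'End(V).
Variables (F : nat -> {vspace V}) (P : nat -> 'End(V)) (D : nat).
Hypothesis FA : filtered_action O F P D.

Let O_linear := fact_linear FA.
Let F0 := fact_F0 FA.
Let F_mono := fact_le FA.
Let F_top := fact_top FA.
Let P_mem := fact_proj FA.
Let P_id := fact_id FA.
Let P_comp := fact_comp FA.
Let O_deg := fact_deg FA.
Let O_comm := fact_comm FA.

(** The projection onto a complement of F k in F k.+1, which stands for the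
    graded part of degree k. *)
Definition gpart k : 'End(V) := P k.+1 - P k.

(** The component of O X m that raises the graded degree by exactly mdeg m. *)
Definition hact X m : 'End(V) :=
  \sum_(k < D) (gpart (k + mdeg m) \o (O X m \o gpart k))%VF.

(** The extension of hact to all matrices of polynomials. Monomials of degree
    at least D act by zero, since there are only D graded parts. *)
Definition gract (Z : 'M[A]_n) : 'End(V) :=
  \sum_(m : 'X_{1..2 < D}) hact (map_mx (mcoeff m) Z) m.

Lemma gpartE k x : gpart k x = P k.+1 x - P k x.
Proof. by rewrite add_lfunE opp_lfunE. Qed.

Lemma gpart_mem k x : gpart k x \in F k.+1.
Proof. by rewrite gpartE memvB // (subvP (F_mono (leqnSn k))). Qed.

Lemma P_min i j x : P i (P j x) = P (minn i j) x.
Proof.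
case: (leqP i j) => [|ji]; first exact: P_comp.
by rewrite P_id // (subvP (F_mono (ltnW ji))).
Qed.

Lemma gpart_low k x : x \in F k -> gpart k x = 0.
Proof.
by move=> xk; rewrite gpartE !P_id ?subrr // (subvP (F_mono (leqnSn k))).
Qed.

Lemma gpart_gpart j k x : gpart j (gpart k x) = (j == k)%:R *: gpart k x.
Proof.
have [jk|kj|->] := ltngtP j k.
- rewrite scale0r gpartE !gpartE !linearB /= !P_min.
  have jk' := ltnW jk.
  by rewrite !(minn_idPl _) // ?addrN ?addNr ?subrr ?addr0 // leqW.
- by rewrite scale0r gpart_low // (subvP (F_mono kj)) // gpart_mem.
rewrite scale1r {1}gpartE P_id ?gpart_mem // [X in P k X]gpartE.
rewrite linearB /= !P_min minnn.
by rewrite (minn_idPl (leqnSn k)) subrr subr0.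
Qed.

Lemma gpart_top k x : (D <= k)%N -> gpart k x = 0.
Proof.
move=> Dk; have e : F k.+1 = F k by rewrite !F_top // leqW.
by rewrite gpartE -(P_comp x (leqnSn k)) [P k _]P_id ?subrr // -e.
Qed.

Lemma gpart_sum x : x \in F D -> \sum_(k < D) gpart k x = x.
Proof.
move=> xD; under eq_bigr do rewrite gpartE.
rewrite -(big_mkord predT (fun k => P k.+1 x - P k x)) telescope_sumr //.
have: P 0 x \in F 0 by apply: P_mem.
by rewrite F0 memv0 => /eqP ->; rewrite subr0 P_id.
Qed.

Lemma hactE X m x :
  hact X m x = \sum_(k < D) gpart (k + mdeg m) (O X m (gpart k x)).
Proof. by rewrite sum_lfunE; apply: eq_bigr => k _; rewrite !comp_lfunE. Qed.

Lemma hact_linear m a X Y : hact (a *: X + Y) m = a *: hact X m + hact Y m.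
Proof.
apply/lfunP=> x; rewrite add_lfunE scale_lfunE !hactE scaler_sumr -big_split.
apply: eq_bigr => k _.
have -> y : O (a *: X + Y) m y = a *: O X m y + O Y m y.
  by rewrite O_linear add_lfunE scale_lfunE.
by rewrite linearP.
Qed.

Lemma hact0 m : hact 0 m = 0.
Proof.
by have := hact_linear m (-1) 0 0; rewrite scaler0 addr0 scaleN1r addNr.
Qed.

Lemma gract_linear a Z Z' : gract (a%:A *: Z + Z') = a *: gract Z + gract Z'.
Proof.
rewrite /gract scaler_sumr -big_split; apply: eq_bigr => m _ /=.
rewrite -hact_linear; congr (hact _ _); apply/matrixP=> i j.
by rewrite !mxE mulr_algl mcoeffD mcoeffZ.
Qed.

Lemma hact_top X m : (D <= mdeg m)%N -> hact X m = 0.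
Proof.
move=> Dm; apply/lfunP=> x; rewrite hactE zero_lfunE big1 // => k _.
by rewrite gpart_top // (leq_trans Dm) // leq_addl.
Qed.

Lemma gract_tens X m : gract (tens X 'X_[m]) = hact X m.
Proof.
have co (m' : 'X_{1..2}) :
    map_mx (mcoeff m') (tens X 'X_[m]) = (m == m')%:R *: X.
  by apply/matrixP=> i j; rewrite !mxE mulr_algr mcoeffZ mcoeffX mulrC.
have z (m' : 'X_{1..2}) : m != m' ->
    hact (map_mx (mcoeff m') (tens X 'X_[m])) m' = 0.
  by move=> /negPf mm'; rewrite co mm' scale0r hact0.
case: (ltnP (mdeg m) D) => [mD|Dm]; last first.
  rewrite hact_top // /gract big1 // => m' _; apply: z.
  by apply: contraTneq (bmdeg m') => <-; rewrite -leqNgt.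
rewrite /gract (bigD1 (BMultinom mD)) //= co eqxx scale1r.
rewrite big1 ?addr0 // => m' ne.
by apply: z; apply: contraNneq ne => e; apply/eqP/val_inj.
Qed.

Lemma hact_gpart X m j x :
  hact X m (gpart j x) = gpart (j + mdeg m) (O X m (gpart j x)).
Proof.
case: (ltnP j D) => [jD|Dj]; last by rewrite gpart_top // !linear0.
rewrite hactE (bigD1 (Ordinal jD)) //= gpart_gpart eqxx scale1r.
rewrite big1 ?addr0 // => k /negPf kj.
by rewrite gpart_gpart (_ : (_ == j) = false) // scale0r !linear0.
Qed.

(** The inner projection drops terms of lower degree, which the outer one
    would have killed. *)
Lemma hact_hact X m Y m' k x : x \in F k.+1 ->
  gpart (k + mdeg m' + mdeg m) (O X m (gpart (k + mdeg m') (O Y m' x))) =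
  gpart (k + mdeg m' + mdeg m) (O X m (O Y m' x)).
Proof.
move=> xk; set y := O Y m' x.
have yk : y \in F (k + mdeg m').+1 by rewrite -addSn O_deg.
rewrite [gpart (k + mdeg m') y]gpartE (P_id yk) !linearB /=.
by rewrite [X in _ - X]gpart_low ?subr0 // O_deg.
Qed.

Lemma hact_comm X m Y m' x :
  hact X m (hact Y m' x) - hact Y m' (hact X m x) =
  hact (X *m Y - Y *m X) (m + m')%MM x.
Proof.
have E X' m1 Y' m2 : hact X' m1 (hact Y' m2 x) =
    \sum_(k < D) gpart (k + mdeg (m1 + m2)) (O X' m1 (O Y' m2 (gpart k x))).
  rewrite [hact Y' m2 x]hactE linear_sum; apply: eq_bigr => k _ /=.
  rewrite hact_gpart hact_hact ?gpart_mem // mdegD.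
  by rewrite [(mdeg m1 + _)%N]addnC addnA.
rewrite !E [(m' + m)%MM]addmC hactE -sumrB; apply: eq_bigr => k _ /=.
apply/eqP; rewrite -subr_eq0 -!(linearB (gpart _)) /=; apply/eqP/gpart_low.
by rewrite mdegD addnA; apply: O_comm; apply: gpart_mem.
Qed.

Lemma gract_bracket Z Z' :
  gract (Z *m Z' - Z' *m Z) = (gract Z \o gract Z')%VF - (gract Z' \o gract Z)%VF.
Proof.
have gD Z1 Z2 : gract (Z1 + Z2) = gract Z1 + gract Z2.
  by have := gract_linear 1 Z1 Z2; rewrite !scale1r.
have g0 : gract 0 = 0 by apply: (addrI (gract 0)); rewrite -gD !addr0.
elim/tens_ind: Z => [|Z1 Z2 H1 H2|X m].
- by rewrite mul0mx mulmx0 subrr g0 comp_lfun0l comp_lfun0r subrr.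
- rewrite mulmxDl mulmxDr opprD addrACA !(gD Z1 Z2) gD H1 H2.
  by rewrite comp_lfunDl comp_lfunDr opprD addrACA.
elim/tens_ind: Z' => [|Z1 Z2 H1 H2|Y m'].
- by rewrite mul0mx mulmx0 subrr g0 comp_lfun0l comp_lfun0r subrr.
- rewrite mulmxDl mulmxDr opprD addrACA !(gD Z1 Z2) gD H1 H2.
  by rewrite comp_lfunDl comp_lfunDr opprD addrACA.
rewrite !tens_mul [X in _ - tens _ X]mulrC tensB -mpolyXD !gract_tens.
by apply/lfunP=> x; rewrite add_lfunE opp_lfunE !comp_lfunE hact_comm.
Qed.

(** Leading terms: this is what transports generation from the filtered to the
    graded action. *)
Lemma hact_lead X m j x : (j < D)%N -> x \in F j.+1 ->
  hact X m x - O X m x \in F (j + mdeg m).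
Proof.
move=> jD xj; rewrite hactE (bigD1 (Ordinal jD)) //=.
rewrite addrAC memvD //; last first.
  apply: memv_suml => k /negPf kj; case: (ltngtP k j) => [kltj|jltk|e].
  - by rewrite (subvP (F_mono _) _ (gpart_mem _ _)) // ltn_add2r.
  - by rewrite [gpart k x]gpart_low ?linear0 ?mem0v // (subvP (F_mono jltk)).
  - by case/eqP: kj; apply: val_inj.
set y := O X m (gpart j x).
have yF : y \in F (j + mdeg m).+1 by rewrite -addSn O_deg ?gpart_mem.
have -> : O X m x = y + O X m (P j x).
  by rewrite -linearD gpartE (P_id xj) subrK.
rewrite opprD addrA memvB ?O_deg // gpartE (P_id yF) addrAC subrr add0r.
by rewrite memvN.
Qed.

Lemma hact_const X x : (forall k z, P k (O X 0%MM z) = O X 0%MM (P k z)) ->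
  x \in F D -> hact X 0%MM x = O X 0%MM x.
Proof.
move=> PO xD; rewrite hactE -[in RHS](gpart_sum xD) linear_sum.
apply: eq_bigr => k _; rewrite mdeg0 addn0 gpartE !PO -linearB -gpartE.
by rewrite gpart_gpart eqxx scale1r.
Qed.

Lemma gract_stable Z x : gract Z x \in F D.
Proof.
rewrite sum_lfunE memv_suml // => m _; rewrite hactE memv_suml // => k _.
have := gpart_mem (k + mdeg m) (O (map_mx (mcoeff m) Z) m (gpart k x)).
case: (leqP D (k + mdeg m).+1) => [Dk|/ltnW kD]; first by rewrite F_top.
exact: (subvP (F_mono kD)).
Qed.

End Graded.

(** * A finite-dimensional representation of a deformation of K[u,v] *)

Section Deformation.
Variables (K : numFieldType) (d l N : nat).
Hypothesis d_gt1 : (1 < d)%N.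
Hypothesis NE : N = (d * l + 1)%N.
Implicit Types (m : 'X_{1..2}) (f : nat -> K) (M : 'M[K]_N).

(** The lowering coefficients: they grow by 1 when i grows by d, vanish at 0 and
    at N, and are nonzero in between. *)
Definition lowc (i : nat) : K := (i %/ d)%:R - (if (d %| i)%N then 0 else l%:R).

Definition upm : 'M[K]_N := \matrix_(i, j) ((i : nat) == j.+1)%:R.

Definition dnm : 'M[K]_N := \matrix_(i, j) ((i.+1 == j)%:R * lowc j).

Definition dgm f : 'M[K]_N := diag_mx (\row_i f i).

Lemma dgmE f i j : dgm f i j = (i == j)%:R * f i.
Proof. by rewrite !mxE; case: eqP => [->|]; rewrite ?mul1r ?mul0r. Qed.

Lemma dgm_mul p f (b : 'M_(N, p)) i j : (dgm f *m b) i j = f i * b i j.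
Proof. by rewrite mul_diag_mx !mxE. Qed.

Lemma mul_dgm f M i j : (M *m dgm f) i j = M i j * f j.
Proof. by rewrite mul_mx_diag !mxE. Qed.

Lemma lowc0 : lowc 0 = 0.
Proof. by rewrite /lowc div0n dvdn0 subrr. Qed.

Lemma lowc_mul_add1 i : lowc (i * d + 1) = i%:R - l%:R.
Proof.
have d0 : (0 < d)%N by apply: ltnW.
rewrite /lowc divnMDl // divn_small // addn0 dvdn_addr ?dvdn_mull //.
by rewrite dvdn1 gtn_eqF.
Qed.

Lemma lowcN : lowc N = 0.
Proof. by rewrite NE mulnC lowc_mul_add1 subrr. Qed.

Lemma lowc_add i : lowc (i + d) = lowc i + 1.
Proof.
have d0 : (0 < d)%N by apply: ltnW.
by rewrite /lowc divnDr // divnn d0 dvdn_addl // natrD -addrA addrAC addrA.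
Qed.

Lemma lowc_neq0 i : (0 < i < N)%N -> lowc i != 0.
Proof.
have d0 : (0 < d)%N by apply: ltnW.
case/andP=> i0; rewrite NE addn1 ltnS => iN.
rewrite /lowc; case: ifP => di.
  by rewrite subr0 pnatr_eq0 -lt0n divn_gt0 // dvdn_leq.
rewrite subr_eq0 eqr_nat ltn_eqF // ltn_divLR // mulnC ltn_neqAle iN andbT.
by apply: contraFneq di => ->; rewrite dvdn_mulr.
Qed.

(** At i = 0, where no basis vector lies below, the formula holds by
    lowc 0 = 0. *)
Lemma upm_dnm : upm * dnm = dgm lowc.
Proof.
apply/matrixP=> i j; rewrite mxE dgmE.
have [i0|i0] := posnP i.
  rewrite i0 lowc0 mulr0 big1 // => k _.
  by rewrite !mxE i0 mul0r.
have pi : (i.-1 < N)%N by rewrite (leq_ltn_trans (leq_pred _)).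
rewrite (bigD1 (Ordinal pi)) //= big1 => [|k ki].
  rewrite !mxE /= prednK // eqxx mul1r addr0 -val_eqE /=.
  by case: eqP => [->|]; rewrite ?mul0r.
rewrite !mxE (_ : (i : nat) == k.+1 = false) ?mul0r //.
by apply: contraNF ki => /eqP ik; apply/eqP/val_inj; rewrite /= ik.
Qed.

(** At the last index, where no basis vector lies above, the formula holds by
    lowc N = 0. *)
Lemma dnm_upm : dnm * upm = dgm (lowc \o S).
Proof.
apply/matrixP=> i j; rewrite mxE dgmE /=.
have [iN|Ni] := ltnP i.+1 N; last first.
  have -> : i.+1 = N by apply/eqP; rewrite eqn_leq Ni ltn_ord.
  rewrite lowcN mulr0 big1 // => k _.
  by rewrite !mxE gtn_eqF ?mul0r // (leq_trans (ltn_ord k)).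
rewrite (bigD1 (Ordinal iN)) //= big1 => [|k ki].
  by rewrite !mxE /= eqxx mul1r addr0 mulrC eqSS.
rewrite !mxE (_ : i.+1 == k = false) ?mul0r //.
by apply: contraNF ki => /eqP ik; apply/eqP/val_inj; rewrite /= ik.
Qed.

(** ** The degree filtration on maps from an isotypic component *)

Fact weight_idx_subproof (j : 'I_l) : (j * d + 1 < N)%N.
Proof. by rewrite NE ltn_add2r mulnC ltn_pmul2l // ltnW. Qed.

Definition weight_idx (j : 'I_l) : 'I_N := Ordinal (weight_idx_subproof j).

(** The inclusion in K^N of the span of the e_(jd+1), an isotypic component
    for the cyclic group. *)
Definition weight_mx : 'M[K]_(N, l) := \matrix_(i, j) (i == weight_idx j)%:R.

(** The monomial u^p v^q of exponent m, in the chosen order of the two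
    operators. *)
Definition omono m : 'M[K]_N := upm ^+ m 0 * dnm ^+ m 1.

Lemma mdeg2 m : mdeg m = (m 0%R + m 1%R)%N.
Proof.
rewrite mdegE !big_ord_recl big_ord0 addn0.
by congr (m _ + m _)%N; apply: val_inj.
Qed.

(** The maps from this component to K^N that are polynomials in the two
    operators of degree less than k. *)
Definition wfil k : {vspace 'M[K]_(N, l)} :=
  <<[seq omono m *m weight_mx | m : 'X_{1..2 < k}]>>%VS.

Lemma wfil_omono k m : (mdeg m < k)%N -> omono m *m weight_mx \in wfil k.
Proof.
move=> mk; apply: memv_span.
by apply/imageP; exists (BMultinom mk).
Qed.

Lemma wfil_pow k p q : (p + q < k)%N ->
  upm ^+ p * dnm ^+ q *m weight_mx \in wfil k.
Proof.
pose m := [multinom [tuple p; q]]; move=> pqk.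
have -> : upm ^+ p * dnm ^+ q = omono m by rewrite /omono !multinomE.
by apply: wfil_omono; rewrite mdeg2 !multinomE.
Qed.

Lemma wfil_ind k (W : {vspace 'M[K]_(N, l)}) :
  (forall m, (mdeg m < k)%N -> omono m *m weight_mx \in W) -> (wfil k <= W)%VS.
Proof.
by move=> mW; apply/span_subvP=> _ /imageP[m _ ->]; apply/mW/bmdeg.
Qed.

Lemma wfil_mul_ind M j k :
  (forall m, (mdeg m < j)%N -> M *m (omono m *m weight_mx) \in wfil k) ->
  forall b, b \in wfil j -> M *m b \in wfil k.
Proof.
move=> mW b bj; have E x : linfun (mulmx M) x = M *m x by rewrite lfunE.
rewrite -E memv_preim; apply: (subvP (wfil_ind _)) bj => m mj.
by rewrite -memv_preim E mW.
Qed.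

Lemma wfil_le j k : (j <= k)%N -> (wfil j <= wfil k)%VS.
Proof.
by move=> jk; apply: wfil_ind => m mj; apply/wfil_omono/(leq_trans mj).
Qed.

Lemma wfil0 : wfil 0 = 0%VS.
Proof. by apply/eqP; rewrite -subv0; apply: wfil_ind. Qed.

(** M behaves as an operator of degree less than r with respect to wfil. The
    index j.+1 makes a strict bound r on the degree add up with the strict
    bound that defines wfil. *)
Definition deg_lt r M :=
  forall j b, b \in wfil j.+1 -> M *m b \in wfil (j + r).

Lemma deg_lt_le r s M : (r <= s)%N -> deg_lt r M -> deg_lt s M.
Proof.
by move=> rs Mr j b /Mr; apply/subvP/wfil_le; rewrite leq_add2l.
Qed.

Lemma deg_ltD r M M' : deg_lt r M -> deg_lt r M' -> deg_lt r (M + M').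
Proof. by move=> Mr Mr' j b bj; rewrite mulmxDl memvD ?Mr ?Mr'. Qed.

Lemma deg_lt0 r : deg_lt r 0.
Proof. by move=> j b _; rewrite mul0mx mem0v. Qed.

Lemma deg_ltZ r a M : deg_lt r M -> deg_lt r (a *: M).
Proof. by move=> Mr j b bj; rewrite -scalemxAl memvZ ?Mr. Qed.

Lemma deg_lt1 : deg_lt 1 1.
Proof. by move=> j b; rewrite mul1mx addn1. Qed.

Lemma deg_ltM r s M M' :
  deg_lt r.+1 M -> deg_lt s M' -> deg_lt (r + s) (M * M').
Proof.
move=> Mr Ms j b /Ms; rewrite -mulmxA.
case e: (j + s)%N => [|k].
  by rewrite wfil0 memv0 => /eqP ->; rewrite mulmx0 mem0v.
by move/Mr; rewrite addnS -addSn -e [(r + s)%N]addnC addnA.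
Qed.

Lemma deg_ltX r M p : deg_lt r.+1 M -> deg_lt (r * p).+1 (M ^+ p).
Proof.
move=> Mr; elim: p => [|p IHp]; first by rewrite muln0 expr0; apply: deg_lt1.
by rewrite exprS mulnS -addnS; apply: deg_ltM.
Qed.

Lemma deg_lt_upm : deg_lt 2 upm.
Proof.
move=> j b; apply: wfil_mul_ind => m mj.
rewrite mulmxA -[upm *m _]/(upm * _) /omono mulrA -exprS.
by apply: wfil_pow; rewrite addSn -mdeg2 addn2 ltnS.
Qed.

Definition periodic f := forall i, f (i + d)%N = f i.

Lemma dgm_upm f : dgm f * upm = upm * dgm (f \o S).
Proof.
apply/matrixP=> i j; rewrite dgm_mul mul_dgm !mxE /=.
by case: eqP => [->|]; rewrite ?mulr0 ?mul0r // mulrC.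
Qed.

Lemma dgm_dnm f : periodic f ->
  dgm f * dnm = dnm * dgm (fun i => f (i + d.-1)%N).
Proof.
move=> pf; apply/matrixP=> i j; rewrite dgm_mul mul_dgm !mxE /=.
case: eqP => [<-|]; rewrite ?mul0r ?mulr0 //.
by rewrite addSnnS prednK ?pf 1?mulrC // ltnW.
Qed.

Lemma dgm_weight f : periodic f -> dgm f *m weight_mx = f 1%N *: weight_mx.
Proof.
move=> pf; apply/matrixP=> i j; rewrite dgm_mul !mxE.
case: eqP => [->|]; rewrite ?mulr0 //=; congr (_ * _).
by elim: (j : nat) => [|k IHk] //; rewrite mulSn -addnA addnC pf.
Qed.

Lemma upmX_mul p q :
  upm ^+ p.+1 * dnm ^+ q *m weight_mx =
  upm *m (upm ^+ p * dnm ^+ q *m weight_mx).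
Proof. by rewrite exprS -mulrA mulmxA. Qed.

Lemma dnmX_mul q : upm ^+ 0 * dnm ^+ q.+1 *m weight_mx =
  dnm *m (upm ^+ 0 * dnm ^+ q *m weight_mx).
Proof. by rewrite expr0 !mul1r exprS mulmxA. Qed.

(** A monomial maps the chosen isotypic component into another one, where a
    diagonal matrix with entries that depend on the residue is a scalar. *)
Lemma dgm_omono f p q : periodic f ->
  exists a : K, dgm f *m (upm ^+ p * dnm ^+ q *m weight_mx)
    = a *: (upm ^+ p * dnm ^+ q *m weight_mx).
Proof.
elim: p f => [|p IHp] f pf; last first.
  have [|a aE] := IHp (f \o S); first by move=> i; apply: (pf i.+1).
  exists a; rewrite upmX_mul mulmxA -[dgm f *m _]/(dgm f * _) dgm_upm.
  by rewrite -mulmxA aE -scalemxAr.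
elim: q f pf => [|q IHq] f pf.
  by exists (f 1%N); rewrite !expr0 mulr1 mul1mx dgm_weight.
have [|a aE] := IHq (fun i => f (i + d.-1)%N).
  by move=> i; rewrite addnAC pf.
exists a; rewrite dnmX_mul mulmxA -[dgm f *m _]/(dgm f * _) dgm_dnm //.
by rewrite -mulmxA aE -scalemxAr.
Qed.

Lemma deg_lt_dgm f : periodic f -> deg_lt 1 (dgm f).
Proof.
move=> pf j b; rewrite addn1; apply: wfil_mul_ind => m mj.
by have [a ->] := dgm_omono (m 0) (m 1) pf; rewrite memvZ // wfil_omono.
Qed.

(** The commutator has entries lowc i.+1 - lowc i, which are periodic: it has
    degree 0, while its two terms have degree 2. *)
Lemma deg_lt_comm : deg_lt 1 (dnm * upm - upm * dnm).
Proof.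
rewrite dnm_upm upm_dnm.
have -> : dgm (lowc \o S) - dgm lowc = dgm (fun i => lowc i.+1 - lowc i).
  apply/matrixP=> i j; rewrite dgmE [LHS]mxE [X in _ + X]mxE !dgmE.
  by rewrite [RHS]mulrBr.
by apply: deg_lt_dgm => i; rewrite -addSn !lowc_add opprD addrACA subrr addr0.
Qed.

(** The lowering operator is moved to the right past the raising ones, at the
    cost of commutators of degree 0. *)
Lemma deg_lt_dnm : deg_lt 2 dnm.
Proof.
move=> j b; apply: wfil_mul_ind => m mj.
suff : dnm *m (omono m *m weight_mx) \in wfil (m 0%R + m 1%R).+2.
  by apply/subvP/wfil_le; rewrite addn2 -mdeg2 ltnS.
rewrite /omono; elim: (m 0) (m 1) => [|p IHp] q.
  by rewrite -dnmX_mul; apply: wfil_pow; rewrite addnS.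
rewrite upmX_mul mulmxA -[dnm *m _]/(dnm * _).
rewrite -[dnm * upm](subrK (upm * dnm)) mulmxDl memvD //.
  apply: (subvP (wfil_le _)) (deg_lt_comm (wfil_pow (ltnSn (p + q)))).
  by rewrite addn1 addSn ltnW.
rewrite -[upm * dnm]/(upm *m dnm) -mulmxA.
by apply: (subvP (wfil_le _)) (deg_lt_upm (IHp q)); rewrite addn2 addSn.
Qed.

Lemma deg_lt_comm_pow p q :
  deg_lt (p + q) (dnm ^+ q * upm ^+ p - upm ^+ p * dnm ^+ q).
Proof.
have step : deg_lt p.+1 (dnm * upm ^+ p - upm ^+ p * dnm).
  elim: p => [|p IHp]; first by rewrite expr0 mulr1 mul1r subrr; apply: deg_lt0.
  have -> : dnm * upm ^+ p.+1 - upm ^+ p.+1 * dnm =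
      (dnm * upm - upm * dnm) * upm ^+ p
      + upm * (dnm * upm ^+ p - upm ^+ p * dnm).
    by rewrite mulrBl mulrBr exprS !mulrA addrA subrK.
  apply: deg_ltD; last exact: (deg_ltM deg_lt_upm IHp).
  apply: (@deg_lt_le p.+1); first exact: leqnSn.
  have := deg_ltM deg_lt_comm (deg_ltX p deg_lt_upm).
  by rewrite mul1n.
elim: q => [|q IHq].
  by rewrite expr0 mul1r mulr1 subrr; apply: deg_lt0.
have -> : dnm ^+ q.+1 * upm ^+ p - upm ^+ p * dnm ^+ q.+1 =
    dnm * (dnm ^+ q * upm ^+ p - upm ^+ p * dnm ^+ q)
    + (dnm * upm ^+ p - upm ^+ p * dnm) * dnm ^+ q.
  by rewrite mulrBl mulrBr exprS !mulrA addrA subrK.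
rewrite addnS; apply: deg_ltD; first exact: (deg_ltM deg_lt_dnm IHq).
by rewrite -addnS; have := deg_ltM step (deg_ltX q deg_lt_dnm); rewrite mul1n.
Qed.

Lemma deg_lt_omono m : deg_lt (mdeg m).+1 (omono m).
Proof.
rewrite mdeg2 -addnS; apply: deg_ltM.
  by have := deg_ltX (m 0) deg_lt_upm; rewrite mul1n.
by have := deg_ltX (m 1) deg_lt_dnm; rewrite mul1n.
Qed.

(** The two operators commute up to terms of lower degree. *)
Lemma deg_lt_omonoM m m' :
  deg_lt (mdeg m + mdeg m') (omono m * omono m' - omono (m + m')%MM).
Proof.
have -> : omono m * omono m' - omono (m + m')%MM = upm ^+ m 0 *
   ((dnm ^+ m 1 * upm ^+ m' 0 - upm ^+ m' 0 * dnm ^+ m 1) * dnm ^+ m' 1).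
  by rewrite /omono !mnmDE !exprD mulrBl mulrBr !mulrA.
have -> : (mdeg m + mdeg m' = m 0%R + ((m' 0%R + m 1%R) + m' 1%R))%N.
  by rewrite !mdeg2 -!addnA; congr (_ + _)%N; rewrite addnCA.
have u p : deg_lt p.+1 (upm ^+ p) by have := deg_ltX p deg_lt_upm; rewrite mul1n.
have v p : deg_lt p.+1 (dnm ^+ p) by have := deg_ltX p deg_lt_dnm; rewrite mul1n.
apply: deg_ltM (u _) _.
case: (posnP (m' 0%R + m 1%R)%N) => [z|].
  have [-> ->] : m' 0 = 0%N /\ m 1 = 0%N.
    by move/eqP: z; rewrite addn_eq0 => /andP[/eqP-> /eqP->].
  by rewrite !expr0 subrr mul0r; apply: deg_lt0.
have := @deg_lt_comm_pow (m' 0) (m 1).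
by case: (_ + _)%N => // k dk _; rewrite addSnnS; apply: deg_ltM dk (v _).
Qed.

Lemma omono_shift m i j : omono m i j != 0 -> (i + m 1%R = j + m 0%R)%N.
Proof.
have nzP p q r (b : 'M[K]_(p, q)) (c : 'M[K]_(q, r)) s t :
    (b *m c) s t != 0 -> exists k, b s k * c k t != 0.
  rewrite mxE => /eqP nz; apply/existsP; apply: contra_notT nz.
  rewrite negb_exists => /forallP z; rewrite big1 // => k _.
  by apply/eqP; rewrite -[_ == _]negbK z.
have up p (i' j' : 'I_N) : (upm ^+ p) i' j' != 0 -> (i' : nat) = (j' + p)%N.
  elim: p i' => [|p IHp] i'.
    by rewrite expr0 mxE addn0; case: (i' =P j') => [->|]; rewrite ?eqxx.
  rewrite exprS => /nzP[k].
  rewrite mulf_eq0 negb_or mxE pnatr_eq0 eqb0 negbK => /andP[/eqP -> /IHp ->].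
  by rewrite addnS.
have dn p (i' j' : 'I_N) : (dnm ^+ p) i' j' != 0 -> (i' + p)%N = j'.
  elim: p i' => [|p IHp] i'.
    by rewrite expr0 mxE addn0; case: (i' =P j') => [->|]; rewrite ?eqxx.
  rewrite exprS => /nzP[k].
  rewrite !mulf_eq0 !negb_or mxE mulf_eq0 negb_or pnatr_eq0 eqb0 negbK.
  by case/andP=> /andP[/eqP e _] /IHp <-; rewrite -e addSnnS.
by move=> /nzP[k]; rewrite mulf_eq0 negb_or => /andP[/up -> /dn <-]; rewrite addnAC.
Qed.

(** ** Exhaustion of the degree filtration *)

Lemma mul_mx_delta_mx M (a : 'I_N) (j : 'I_l) i k :
  (M *m delta_mx a j) i k = M i a * (k == j)%:R.
Proof.
rewrite mxE (bigD1 a) //= big1 => [|t /negPf ta]; rewrite !mxE ?eqxx ?addr0 //.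
by rewrite ta mulr0.
Qed.

(** The operator upm * dnm is diagonal with entries lowc i, so polynomials in
    it are diagonal as well. *)
Lemma deg_lt_dgm_prod (r : seq K) :
  deg_lt (size r).*2.+1 (dgm (fun i => \prod_(s <- r) (lowc i - s))).
Proof.
elim: r => [|s r IHr] /=.
  rewrite [dgm _](_ : _ = 1); first exact: deg_lt1.
  by apply/matrixP=> i j; rewrite dgmE mxE big_nil mulr1.
rewrite [dgm _](_ : _ =
    (dgm lowc - s%:M) * dgm (fun i => \prod_(t <- r) (lowc i - t))); last first.
  apply/matrixP=> i j; rewrite mul_dgm dgmE big_cons !mxE.
  by case: (i =P j) => [->|_]; rewrite ?mul1r // !mul0r subr0 mul0r.
rewrite doubleS -[in X in deg_lt X]add2n; apply: deg_ltM IHr.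
apply: deg_ltD.
  rewrite -upm_dnm; exact: (deg_ltM deg_lt_upm deg_lt_dnm).
rewrite -scaleN1r -scalemx1; apply/deg_ltZ/deg_ltZ.
by apply: deg_lt_le deg_lt1.
Qed.

(** Lagrange interpolation: the values of lowc at the indices jd+1 are the
    pairwise distinct numbers j - l. *)
Lemma wfil_diag (j : 'I_l) : delta_mx (weight_idx j) j \in wfil l.*2.+1.
Proof.
pose r := [seq (k : 'I_l)%:R - l%:R | k <- enum 'I_l & k != j] : seq K.
pose f i := \prod_(s <- r) (lowc i - s).
have fE (k : 'I_l) : f (k * d + 1)%N = \prod_(i < l | i != j) (k%:R - i%:R).
  rewrite /f lowc_mul_add1 /r big_map big_filter big_enum_cond /=.
  by apply: eq_bigr => i _; rewrite opprB addrA subrK.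
have f0 : f (weight_idx j) != 0.
  rewrite fE; apply/prodf_neq0 => i /negPf ij.
  by rewrite subr_eq0 eqr_nat eq_sym val_eqE ij.
have -> : delta_mx (weight_idx j) j =
    (f (weight_idx j))^-1 *: (dgm f *m weight_mx).
  apply/matrixP=> i k; rewrite [in RHS]mxE dgm_mul !mxE.
  have [->|kj] := eqVneq k j; rewrite ?andbF ?andbT.
    by case: eqP => [->|]; rewrite ?mulr0 // mulr1 mulVf.
  have fk0 : f (weight_idx k) = 0 by rewrite fE (bigD1 k) //= subrr mul0r.
  by case: eqP => [->|]; rewrite ?mulr0 // fk0 mul0r mulr0.
rewrite memvZ //.
have := @deg_lt_dgm_prod r 0 weight_mx _; rewrite add0n => H.
have: dgm f *m weight_mx \in wfil (size r).*2.+1.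
  by apply: H; have := @wfil_pow 1 0 0 isT; rewrite !expr0 mul1r mul1mx.
apply/subvP/wfil_le; rewrite ltnS leq_double size_map size_filter.
by rewrite (leq_trans (count_size _ _)) // size_enum_ord.
Qed.

(** From e_(jd+1) every basis vector is reached by raising or by lowering, the
    lowering coefficients being nonzero. *)
Lemma wfil_full : exists k, wfil k = fullv.
Proof.
exists (l.*2.+1 + N)%N; apply/eqP; rewrite eqEsubv subvf /=.
apply/subvP=> b _; rewrite [b]matrix_sum_delta.
apply: memv_suml => i _; apply: memv_suml => j _; rewrite memvZ //.
have up p (a : 'I_N) : (a = weight_idx j + p :> nat)%N ->
    delta_mx a j \in wfil (l.*2.+1 + p).
  elim: p a => [|p IHp] a ae.
    have -> : a = weight_idx j by apply: ord_inj; rewrite ae addn0.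
    by rewrite addn0 wfil_diag.
  have pN : (weight_idx j + p < N)%N.
    by apply: leq_ltn_trans (ltn_ord a); rewrite ae leq_add2l.
  have -> : delta_mx a j = upm *m delta_mx (Ordinal pN) j.
    have e : (Ordinal pN).+1 = a by rewrite ae addnS.
    apply/matrixP=> i' k; rewrite mul_mx_delta_mx mxE [upm _ _]mxE e.
    by rewrite -natrM mulnb.
  apply: (subvP (wfil_le _)) (deg_lt_upm (j := (l.*2 + p)%N) (IHp _ _)) => //.
  by rewrite addn2 addSn addnS.
have dn p (a : 'I_N) : (a + p = weight_idx j)%N ->
    delta_mx a j \in wfil (l.*2.+1 + p).
  elim: p a => [|p IHp] a ae.
    have -> : a = weight_idx j by apply: ord_inj; rewrite -ae addn0.
    by rewrite addn0 wfil_diag.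
  have pN : (a.+1 < N)%N.
    apply: leq_ltn_trans (ltn_ord (weight_idx j)).
    by rewrite -ae addnS ltnS leq_addr.
  have -> : delta_mx a j = (lowc a.+1)^-1 *: (dnm *m delta_mx (Ordinal pN) j).
    apply/matrixP=> i' k; rewrite [RHS]mxE mul_mx_delta_mx !mxE /= eqSS val_eqE.
    rewrite [_ * lowc _]mulrC -mulrA mulKf ?lowc_neq0 //.
    by rewrite -natrM mulnb.
  rewrite memvZ //.
  apply: (subvP (wfil_le _)) (deg_lt_dnm (j := (l.*2 + p)%N) (IHp _ _)).
    by rewrite addn2 addSn addnS.
  by rewrite /= addSnnS.
have [ji|ij] := leqP (weight_idx j) i.
  apply: (subvP (wfil_le _)) (up (i - weight_idx j)%N i _).
    by rewrite leq_add2l (leq_trans (leq_subr _ _)) // ltnW.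
  by rewrite subnKC.
apply: (subvP (wfil_le _)) (dn (weight_idx j - i)%N i _).
  by rewrite leq_add2l (leq_trans (leq_subr _ _)) // ltnW.
by rewrite subnKC // ltnW.
Qed.

End Deformation.

(** * The tensor product of the two natural representations *)

Section TensorOp.
Variables (C : fieldType) (n N : nat).
Local Notation U := {ffun 'I_N -> 'cV[C]_n}.
Implicit Types (X Y : 'M[C]_n) (M : 'M[C]_N).

Definition std_vec (t : 'I_N * 'I_n) : U :=
  [ffun j => (j == t.1)%:R *: delta_mx t.2 0].

Definition std_coord (u : U) (t : 'I_N * 'I_n) : C := u t.1 t.2 0.

Fact std_coordP a (u v : U) t :
  std_coord (a *: u + v) t = a * std_coord u t + std_coord v t.
Proof. by rewrite /std_coord !ffunE !mxE. Qed.

Fact std_coord_vec s t : std_coord (std_vec s) t = (s == t)%:R.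
Proof.
rewrite /std_coord ffunE !mxE eqxx andbT -natrM mulnb eq_sym [t.2 == _]eq_sym.
by case: s t => [s1 s2] [t1 t2].
Qed.

Fact std_frameE (u : U) : u = \sum_t std_coord u t *: std_vec t.
Proof.
apply/ffunP=> j; rewrite sum_ffunE.
rewrite -(pair_bigA _ (fun k a => (u k a 0 *: std_vec (k, a)) j)) /=.
rewrite (bigD1 j) //= [X in _ + X]big1 => [|k kj].
  rewrite addr0; apply/colP=> a; rewrite summxE (bigD1 a) //= big1 => [|c ca].
    by rewrite !ffunE !mxE !eqxx !mulr1 addr0.
  by rewrite !ffunE !mxE [a == c]eq_sym (negPf ca) !mulr0.
by rewrite big1 // => a _; rewrite !ffunE eq_sym (negPf kj) scale0r scaler0.
Qed.

Definition std_frame : frame U ('I_N * 'I_n)%type :=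
  Frame std_coordP std_coord_vec std_frameE.

(** X (x) M on the tensor product of K^n and K^N, written as a sum of N copies
    of K^n. *)
Definition kron_fun X M (u : U) : U := [ffun j => \sum_k M j k *: (X *m u k)].

Fact kron_fun_linear X M : linear (kron_fun X M).
Proof.
move=> a u v; apply/ffunP=> j; rewrite !ffunE scaler_sumr -big_split.
apply: eq_bigr => k _ /=; rewrite !ffunE mulmxDr -scalemxAr scalerDr.
by rewrite !scalerA mulrC.
Qed.

HB.instance Definition _ X M :=
  GRing.isLinear.Build C U U *:%R (kron_fun X M) (kron_fun_linear X M).

Definition kron X M : 'End(U) := linfun (kron_fun X M).

Lemma kronE X M u j : kron X M u j = \sum_k M j k *: (X *m u k).
Proof. by rewrite lfunE /= ffunE. Qed.

Lemma kron_linearl M a X Y : kron (a *: X + Y) M = a *: kron X M + kron Y M.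
Proof.
apply/lfunP=> u; rewrite add_lfunE scale_lfunE.
apply/ffunP=> j; rewrite !ffunE !kronE scaler_sumr -big_split /=.
apply: eq_bigr => k _.
by rewrite mulmxDl -scalemxAl scalerDr !scalerA mulrC.
Qed.

Lemma kronBl M X Y : kron (X - Y) M = kron X M - kron Y M.
Proof. by rewrite addrC -scaleN1r kron_linearl scaleN1r addrC. Qed.

Lemma kronBr X M M' : kron X (M - M') = kron X M - kron X M'.
Proof.
apply/lfunP=> u; rewrite add_lfunE opp_lfunE.
apply/ffunP=> j; rewrite !ffunE !kronE -sumrB.
by apply: eq_bigr => k _; rewrite !mxE scalerBl.
Qed.

Lemma kron_comp X Y M M' : (kron X M \o kron Y M')%VF = kron (X *m Y) (M *m M').
Proof.
apply/lfunP=> u; rewrite comp_lfunE; apply/ffunP=> j; rewrite !kronE.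
under eq_bigr do rewrite kronE mulmx_sumr scaler_sumr.
rewrite exchange_big /=; apply: eq_bigr => k _.
rewrite mxE scaler_suml; apply: eq_bigr => i _.
by rewrite -scalemxAr scalerA mulmxA.
Qed.

Lemma kron1 X : kron X 1%:M = dsum_act (nat_rep C n) N X.
Proof.
have natE (v : 'cV[C]_n) : nat_act X v = X *m v by rewrite lfunE.
have dsumE (V : sl_module C^o n) (Y : 'M[C^o]_n) (w : {ffun 'I_N -> V}) :
    dsum_act V N Y w = dsum_fun Y w by rewrite lfunE.
apply/lfunP=> u; transitivity (dsum_fun (V := nat_rep C n) X u); last first.
  exact: (esym (dsumE (nat_rep C n) X u)).
apply/ffunP=> j; rewrite kronE [RHS]ffunE [RHS]natE.
rewrite (bigD1 j) //= big1 => [|k kj]; last first.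
  by rewrite mxE eq_sym (negPf kj) scale0r.
by rewrite mxE eqxx scale1r addr0.
Qed.

(** The map v (x) b from an l-dimensional space to the tensor product, given
    by the images of the l basis vectors. *)
Definition ten l (v : 'cV[C]_n) (b : 'M[C]_(N, l)) : {ffun 'I_l -> U} :=
  [ffun j => [ffun i => b i j *: v]].

Lemma kron_ten l X M v (b : 'M[C]_(N, l)) :
  [ffun j => kron X M (ten v b j)] = ten (X *m v) (M *m b).
Proof.
apply/ffunP=> j; rewrite !ffunE; apply/ffunP=> i; rewrite kronE !ffunE mxE.
rewrite scaler_suml; apply: eq_bigr => k _.
by rewrite !ffunE -scalemxAr scalerA.
Qed.

Lemma ten_linearr l v a (b b' : 'M[C]_(N, l)) :
  ten v (a *: b + b') = a *: ten v b + ten v b'.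
Proof.
apply/ffunP=> j; rewrite !ffunE; apply/ffunP=> i.
by rewrite !ffunE !mxE scalerDl scalerA.
Qed.

Lemma ten_linearl l a v v' (b : 'M[C]_(N, l)) :
  ten (a *: v + v') b = a *: ten v b + ten v' b.
Proof.
apply/ffunP=> j; rewrite !ffunE; apply/ffunP=> i.
by rewrite !ffunE scalerDr !scalerA mulrC.
Qed.

HB.instance Definition _ l v :=
  GRing.isLinear.Build C _ _ *:%R (@ten l v) (@ten_linearr l v).

Lemma tenZ l a (v : 'cV[C]_n) (b : 'M[C]_(N, l)) :
  ten (a *: v) b = a *: ten v b.
Proof.
apply/ffunP=> j; rewrite !ffunE; apply/ffunP=> i.
by rewrite !ffunE !scalerA mulrC.
Qed.

End TensorOp.

(** The standard basis is orthonormal, so the conjugate transpose of X is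
    adjoint to X. *)
Lemma kron1_adj (C : numClosedFieldType) n N (X : 'M[C]_n) s t :
  fcoord (std_frame C n N) (kron X 1%:M (fvec (std_frame C n N) s)) t =
  (fcoord (std_frame C n N)
     (kron (map_mx Num.conj X)^T 1%:M (fvec (std_frame C n N) t)) s)^*.
Proof.
have E Y s' t' :
    fcoord (std_frame C n N) (kron Y 1%:M (fvec (std_frame C n N) s')) t' =
    (t'.1 == s'.1)%:R * Y t'.2 s'.2.
  rewrite /= /std_coord kronE (bigD1 t'.1) //= big1 => [|k kt]; last first.
    by rewrite mxE eq_sym (negPf kt) scale0r.
  rewrite addr0 [1%:M _ _]mxE eqxx scale1r ffunE -scalemxAr mxE; congr (_ * _).
  rewrite mxE (bigD1 s'.2) //= big1 => [|k ks]; rewrite !mxE ?eqxx.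
    by rewrite mulr1 addr0.
  by rewrite (negPf ks) mulr0.
by rewrite !E rmorphM /= conjC_nat !mxE conjCK eq_sym.
Qed.

(** * Symmetrised wedge products *)

Section SymWedge.
Variables (K : fieldType) (l : nat) (U : vectType K) (T : finType).
Variable B : frame U T.
Local Notation H := {ffun 'I_l -> U}.
Implicit Type z : {ffun 'I_l -> H}.
Local Notation Ten := {ffun {ffun 'I_l -> T} -> K^o}.

(** z i is a linear map from an l-dimensional space, given by the images of
    its basis vectors. This is the image of the symmetric product of the z i
    in the exterior power, applied to the wedge of the l basis vectors. *)
Definition symw z : Ten :=
  \sum_(s : 'S_l) wedge B [ffun j => z (s j) j].

Lemma symw_multilinear : multilinear symw.
Proof.
move=> z i a x y; rewrite /symw scaler_sumr -big_split /=.
apply: eq_bigr => s _; pose j := (s^-1)%g i.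
have E w : [ffun k => upd z i w (s k) k] = upd [ffun k => z (s k) k] j (w j).
  apply/ffunP=> k; rewrite !ffunE -[in RHS](inj_eq (@perm_inj _ s)) permKV.
  by case: eqP => // e; rewrite /j -e permK.
by rewrite !E !ffunE (wedge_multilinear B).
Qed.

Lemma symw_perm z (s : 'S_l) : symw [ffun i => z (s i)] = symw z.
Proof.
rewrite /symw [RHS](reindex_inj (mulIg s)) /=; apply: eq_bigr => r _.
by congr wedge; apply/ffunP=> j; rewrite !ffunE permM.
Qed.

Lemma symw_ext z : symw z \in ext l B.
Proof. by apply: memv_suml => s _; apply: wedge_ext. Qed.

Lemma der_symw g z :
  der B g (symw z) = \sum_i symw (upd z i [ffun j => g (z i j)]).
Proof.
rewrite linear_sum [RHS]exchange_big /=; apply: eq_bigr => s _.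
rewrite der_wedge [RHS](reindex_inj (@perm_inj _ s)) /=; apply: eq_bigr => j _.
congr wedge; apply/ffunP=> k; rewrite !ffunE (inj_eq perm_inj).
by case: eqP => [->|//]; rewrite !ffunE.
Qed.

Lemma symw_diag (u : {ffun 'I_l -> U}) :
  symw [ffun i => [ffun j => (i == j)%:R *: u j]] = wedge B u.
Proof.
rewrite /symw (bigD1 1%g) //= big1 ?addr0 => [|s s1].
  congr wedge; apply/ffunP=> j.
  by rewrite !ffunE perm1 eqxx scale1r.
have [j sj] : exists j, s j != j.
  apply/existsP; rewrite -negb_forall; apply: contraNN s1 => /forallP e.
  by apply/eqP/permP=> j; rewrite perm1; apply/eqP.
apply: (multilinear0 (wedge_multilinear B) (i := j)).
by rewrite !ffunE (negPf sj) scale0r.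
Qed.

Lemma symw_const (u : H) : symw [ffun=> u] = l`!%:R *: wedge B u.
Proof.
rewrite -card_Sn scaler_nat -sumr_const; apply: eq_big => [s|s _].
  by rewrite inE.
by congr wedge; apply/ffunP=> j; rewrite !ffunE.
Qed.

End SymWedge.

(** * The filtration of the exterior power *)

Section Filtration.
Variables (C : numFieldType) (n d l N : nat).
Hypothesis d_gt1 : (1 < d)%N.
Hypothesis NE : N = (d * l + 1)%N.
Local Notation U := {ffun 'I_N -> 'cV[C]_n}.
Local Notation H := {ffun 'I_l -> U}.
Local Notation T := ('I_N * 'I_n)%type.
Local Notation Ten := {ffun {ffun 'I_l -> T} -> C^o}.
Local Notation B := (std_frame C n N).
Local Notation wfil := (wfil C d_gt1 NE).
Local Notation weight_mx := (weight_mx C d_gt1 NE).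
Local Notation omono := (omono C d l N).
Local Notation deg_lt := (deg_lt d_gt1 NE).
Local Notation label := ('I_n * 'X_{1..2})%type.
Implicit Types (t : {ffun 'I_l -> label}).

(** The map v_c (x) u^p v^q on the chosen isotypic component. *)
Definition slot (p : label) : H :=
  ten (delta_mx p.1 0) (omono p.2 *m weight_mx).

Definition slots t : {ffun 'I_l -> H} := [ffun i => slot (t i)].

Definition tdeg t := (\sum_i mdeg (t i).2)%N.

(** Labels with monomials of bounded degree form a finite type, over which a
    spanning family can range. *)
Definition bd_label k (p : 'I_n * 'X_{1..2 < k}) : label := (p.1, bmnm p.2).

Definition bd_labels k (e : {ffun 'I_l -> 'I_n * 'X_{1..2 < k}}) :
  {ffun 'I_l -> label} := [ffun i => bd_label (e i)].

Definition fil k : {vspace Ten} :=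
  <<[seq symw B (slots (bd_labels e))
    | e in [pred e : {ffun 'I_l -> 'I_n * 'X_{1..2 < k}} |
        (tdeg (bd_labels e) < k)%N]]>>%VS.

Lemma mdeg_tdeg t i : (mdeg (t i).2 <= tdeg t)%N.
Proof. by rewrite /tdeg (bigD1 i) //= leq_addr. Qed.

Lemma fil_slots t k : (tdeg t < k)%N -> symw B (slots t) \in fil k.
Proof.
move=> tk; have bd i : (mdeg (t i).2 < k)%N.
  exact: leq_ltn_trans (mdeg_tdeg t i) tk.
pose t' : {ffun 'I_l -> 'I_n * 'X_{1..2 < k}} :=
  [ffun i => ((t i).1, BMultinom (bd i))].
have tE : t = bd_labels t'.
  by apply/ffunP=> i; rewrite !ffunE /bd_label /=; case: (t i).
apply: memv_span; apply/imageP; exists t'; last by rewrite -tE.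
by rewrite unfold_in -tE.
Qed.

Lemma fil_ind k (W : {vspace Ten}) :
  (forall t, (tdeg t < k)%N -> symw B (slots t) \in W) -> (fil k <= W)%VS.
Proof. by move=> tW; apply/span_subvP=> _ /imageP[t tk ->]; apply: tW. Qed.

Lemma fil_le j k : (j <= k)%N -> (fil j <= fil k)%VS.
Proof. by move=> jk; apply: fil_ind => t tj; apply/fil_slots/(leq_trans tj). Qed.

Lemma fil0 : fil 0 = 0%VS.
Proof. by apply/eqP; rewrite -subv0; apply: fil_ind. Qed.

Lemma fil_ext k : (fil k <= ext l B)%VS.
Proof. by apply: fil_ind => t _; apply: symw_ext. Qed.

Definition slot_seq r : seq H := [seq slot (bd_label p) | p : 'I_n * 'X_{1..2 < r}].

Lemma slot_seqP r z : reflect (exists2 p, (mdeg p.2 < r)%N & z = slot p)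
  (z \in slot_seq r).
Proof.
apply: (iffP imageP) => [[p _ ->]|[[c m] mr ->]].
  by exists (bd_label p) => //; apply: bmdeg.
by exists (c, BMultinom mr).
Qed.

Lemma ten_slot v b r : b \in wfil r -> ten v b \in <<slot_seq r>>%VS.
Proof.
move=> br; have E x : linfun (ten (l := l) (N := N) v) x = ten v x by rewrite lfunE.
rewrite -E memv_preim; apply: (subvP (wfil_ind _)) br => m mr.
rewrite -memv_preim E [v]matrix_sum_delta.
under eq_bigr do rewrite big_ord1.
elim/big_rec: _ => [|c w _ wr].
  rewrite (_ : ten 0 _ = 0) ?mem0v //.
  apply/ffunP=> j; rewrite !ffunE; apply/ffunP=> i.
  by rewrite !ffunE scaler0.
rewrite ten_linearl memvD // memvZ // memv_span //.
by apply/slot_seqP; exists (c, m).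
Qed.

(** Each slot may be filled by a combination of monomials of bounded degree. *)
Lemma fil_span (kap : 'I_l -> nat) (z : {ffun 'I_l -> H}) k :
  (\sum_i kap i < k)%N -> (forall i, z i \in <<slot_seq (kap i).+1>>%VS) ->
  symw B z \in fil k.
Proof.
move=> kapk; apply: (multilinear_mem (symw_multilinear B)) => {}z zs.
have t_ i : {p | z i == slot p & (mdeg p.2 <= kap i)%N}.
  apply: sig2W; have /slot_seqP[p pk zi] := zs i.
  by exists p; rewrite ?zi // -ltnS.
pose t : {ffun 'I_l -> label} := [ffun i => s2val (t_ i)].
have -> : z = slots t.
  by apply/ffunP=> i; rewrite !ffunE; apply/eqP; case: (t_ i).
apply: fil_slots; apply: leq_ltn_trans kapk; apply: leq_sum => i _.
by rewrite ffunE; case: (t_ i).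
Qed.

Lemma slots_upd t i p : upd (slots t) i (slot p) = slots (upd t i p).
Proof. by apply/ffunP=> k; rewrite !ffunE; case: eqP. Qed.

Lemma fil_upd_slot t i k r z :
  (\sum_(j | j != i) mdeg (t j).2 + r <= k)%N -> z \in <<slot_seq r>>%VS ->
  symw B (upd (slots t) i z) \in fil k.
Proof.
move=> tk zr; apply: (multilinear_span (symw_multilinear B)) zr _.
move=> y /slot_seqP[p pr ->]; rewrite slots_upd; apply: fil_slots.
rewrite /tdeg (bigD1 i) //= upd_same addnC.
apply: leq_trans tk; rewrite -addnS.
rewrite (eq_bigr (fun j => mdeg (t j).2)) ?leq_add2l // => j ji.
by rewrite upd_other.
Qed.

Lemma der_slots X (M : 'M[C]_N) t :
  der B (kron X M) (symw B (slots t)) = \sum_i symw B (upd (slots t) i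
     (ten (X *m delta_mx (t i).1 0) (M *m (omono (t i).2 *m weight_mx)))).
Proof.
by rewrite der_symw; apply: eq_bigr => i _; rewrite ffunE -kron_ten.
Qed.

(** A derivation acts on one slot at a time, where the degree is controlled by
    wfil. *)
Lemma der_fil X (M : 'M[C]_N) r k phi : deg_lt r M -> phi \in fil k.+1 ->
  der B (kron X M) phi \in fil (k + r).
Proof.
move=> Mr phik; rewrite memv_preim; apply: (subvP (fil_ind _)) phik => t tk.
rewrite -memv_preim der_slots; apply: memv_suml => i _.
apply: (@fil_upd_slot _ _ _ (mdeg (t i).2 + r)%N).
  by move: tk; rewrite ltnS /tdeg (bigD1 i) //= addnA leq_add2r addnC.
by apply/ten_slot/Mr/wfil_omono.
Qed.

(** A wedge of l basis vectors t_j is the symmetrised wedge of the maps that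
    send the j-th basis vector to t_j and the other ones to 0: for a
    nontrivial permutation some factor vanishes. These maps have bounded
    degree by wfil_full. *)
Lemma fil_full : exists D, fil D = ext l B.
Proof.
have [k wk] := wfil_full C d_gt1 NE.
exists (\sum_(i < l) k).+1; apply/eqP; rewrite eqEsubv fil_ext /=.
apply/span_subvP=> _ /imageP[t _ ->].
rewrite -symw_diag; apply: (fil_span (kap := fun=> k)) => // i.
have -> : [ffun i0 => [ffun j => (i0 == j)%:R *: bvec B t j]] i =
   ten (delta_mx (t i).2 0) (delta_mx (t i).1 i).
  apply/ffunP=> j; rewrite !ffunE; apply/ffunP=> a; rewrite !ffunE mxE scalerA.
  rewrite -natrM mulnb [j == i]eq_sym andbC.
  by case: (i =P j) => [->|_] //; rewrite !andbF !scale0r.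
have: delta_mx (t i).1 i \in wfil k by rewrite wk memvf.
move/(ten_slot (delta_mx (t i).2 0)); apply/subvP/sub_span => y.
move=> /slot_seqP[p pk ->]; apply/slot_seqP.
by exists p => //; apply: ltnW.
Qed.

End Filtration.

(** * Restriction of endomorphisms to a subspace *)

Section Restrict.
Variables (K : fieldType) (V : vectType K) (M : {vspace V}).
Implicit Types f g : 'End(V).

Definition restr f : 'End(subvs_of M) :=
  (linfun (vsproj M) \o (f \o linfun vsval))%VF.

Definition stable f := forall x, x \in M -> f x \in M.

Lemma restrE f v : stable f -> vsval (restr f v) = f (vsval v).
Proof.
move=> fM; rewrite 2!comp_lfunE.
have -> : linfun vsval v = vsval v :> V by rewrite lfunE.
have -> x : linfun (vsproj M) x = vsproj M x by rewrite lfunE.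
by rewrite vsprojK // fM // subvsP.
Qed.

Lemma restr_linear : linear restr.
Proof.
move=> a f g; rewrite /restr comp_lfunDl comp_lfunDr.
by rewrite -comp_lfunZl -comp_lfunZr.
Qed.

Lemma restr_comp f g : stable f -> stable g ->
  restr (f \o g)%VF = (restr f \o restr g)%VF.
Proof.
move=> fM gM; apply/lfunP=> v; apply/val_inj => /=.
rewrite [RHS](_ : _ = f (g (vsval v))); last first.
  by rewrite comp_lfunE -restrE // -restrE.
by rewrite -comp_lfunE -restrE // => x /gM /fM; rewrite comp_lfunE.
Qed.

End Restrict.

(** * The invariant polynomials *)

Section Invariant.
Variables (C : fieldType) (d : nat) (zeta : C).
Hypothesis zetaP : d.-primitive_root zeta.

Lemma mcoeff_cyc_xi (P : {mpoly C[2]}) m :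
  (cyc_xi zeta P)@_m = zeta ^+ m 0 * zeta^-1 ^+ m 1 * P@_m.
Proof.
elim/mpolyind: P => [|c m' P _ _ IH].
  by rewrite /cyc_xi comp_mpoly0 !mcoeff0 mulr0.
rewrite /cyc_xi linearP /= mcoeffD [X in _ + X]IH.
rewrite linearD /= mulrDr !mcoeffZ mulrCA; congr (_ * _ + _).
rewrite comp_mpolyX !big_ord_recl big_ord0 mulr1 /=.
rewrite !exprZn -scalerAl -scalerAr scalerA !mcoeffZ.
have -> : ('X_ord0 ^+ m' ord0 * 'X_(lift ord0 ord0) ^+ m' (lift ord0 ord0))
    = 'X_[C, m'].
  by rewrite [RHS]mpolyXE_id !big_ord_recl big_ord0 mulr1.
rewrite mcoeffX; case: eqP => [->|]; last by rewrite !mulr0.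
by rewrite !mulr1; congr (_ * _ ^+ _); congr (m _); apply: val_inj.
Qed.

Lemma cyc_invariant_mod P m : cyc_invariant zeta P -> P@_m != 0 ->
  m 0 = m 1 %[mod d].
Proof.
move=> /(_ 1%N) /= inv Pm; apply/eqP; rewrite -(eq_prim_root_expr zetaP).
have z0 : zeta != 0.
  apply/eqP=> z0; have := prim_expr_order zetaP; rewrite z0 expr0n.
  by rewrite gtn_eqF ?(prim_order_gt0 zetaP) // => /eqP; rewrite eq_sym oner_eq0.
have := mcoeff_cyc_xi P m; rewrite inv => /eqP.
rewrite -[X in X == _]mul1r (inj_eq (mulIf Pm)) exprVn => /eqP e.
by rewrite -[X in _ == X]mul1r e mulfVK ?expf_neq0.
Qed.

End Invariant.

Lemma meval_at0 (R : comNzRingType) n (P : {mpoly R[n]}) :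
  P.@[fun=> 0] = P@_0%MM.
Proof.
elim/mpolyind: P => [|c m P _ _ IH]; first by rewrite meval0 mcoeff0.
rewrite mevalD mevalZ IH mcoeffD mcoeffZ mcoeffX; congr (_ * _ + _).
rewrite mevalX; have [->|/eqP m0] := eqVneq m 0%MM.
  by rewrite big1 // => i _; rewrite mnm0E expr0.
have [i mi] : exists i, m i != 0%N.
  apply/existsP; rewrite -negb_forall; apply/negP=> /forallP z.
  by case: m0; apply/mnmP=> i; rewrite mnm0E; apply/eqP.
by rewrite (bigD1 i) //= expr0n (negPf mi) mul0r.
Qed.

(** * The quotient of the Weyl module *)

Section WeylQuotient.
Variables (C : numClosedFieldType) (n d l N : nat).
Hypothesis n_gt1 : (1 < n)%N.
Hypothesis d_gt1 : (1 < d)%N.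
Hypothesis NE : N = (d * l + 1)%N.
Local Notation A := {mpoly C[2]}.
Local Notation U := {ffun 'I_N -> 'cV[C]_n}.
Local Notation T := ('I_N * 'I_n)%type.
Local Notation Ten := {ffun {ffun 'I_l -> T} -> C^o}.
Local Notation B := (std_frame C n N).
Local Notation weight_mx := (weight_mx C d_gt1 NE).
Local Notation omono := (omono C d l N).
Local Notation label := ('I_n * 'X_{1..2})%type.
Local Notation fil := (fil C n d_gt1 NE).
Local Notation slot := (slot C d_gt1 NE).
Local Notation slots := (slots C d_gt1 NE).
Local Notation M := (ext l B).
Implicit Types (X Y G : 'M[C]_n) (m : 'X_{1..2}) (t : {ffun 'I_l -> label}).

Let i0 : 'I_n := Ordinal (ltnW n_gt1).
Let i1 : 'I_n := Ordinal n_gt1.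

Definition oact X m : 'End(Ten) := der B (kron X (omono m)).

Definition fproj k : 'End(Ten) := oproj (fil k).

Lemma oact_linear m a X Y : oact (a *: X + Y) m = a *: oact X m + oact Y m.
Proof. by rewrite /oact kron_linearl; apply: der_linear. Qed.

Lemma oact_deg X m k x : x \in fil k -> oact X m x \in fil (k + mdeg m).
Proof.
case: k => [|k] xk.
  by move: xk; rewrite fil0 memv0 => /eqP ->; rewrite linear0 mem0v.
by rewrite addSnnS; apply: der_fil xk; apply: deg_lt_omono.
Qed.

(** The bracket of X (x) M and Y (x) M' is XY (x) MM' - YX (x) M'M, and both
    products of monomials agree with the normally ordered monomial up to lower
    degree. *)
Lemma oact_comm X Y m m' k x : x \in fil k.+1 ->
  oact X m (oact Y m' x) - oact Y m' (oact X m x)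
    - oact (X *m Y - Y *m X) (m + m')%MM x
  \in fil (k + mdeg m + mdeg m').
Proof.
move=> xk; pose E X' m1 m2 := kron X' (omono m1 *m omono m2 - omono (m1 + m2)%MM).
have -> : oact X m (oact Y m' x) - oact Y m' (oact X m x)
    - oact (X *m Y - Y *m X) (m + m')%MM x =
    der B (E (X *m Y) m m') x - der B (E (Y *m X) m' m) x.
  rewrite /oact -!comp_lfunE.
  have subE (f g : 'End(Ten)) y : f y - g y = (f - g) y.
    by rewrite add_lfunE opp_lfunE.
  rewrite !subE -der_comm !kron_comp -!linearB /=; congr (der B _ x).
  rewrite /E !kronBr [(m' + m)%MM]addmC kronBl.
  set a := kron _ _; set b := kron _ _; set c := kron _ _; set e := kron _ _.
  by rewrite !opprB addrACA [RHS]addrACA [- b + _]addrC.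
rewrite -addnA memvB //.
  by apply: der_fil xk; apply: deg_lt_omonoM.
rewrite [(mdeg m + mdeg m')%N]addnC.
by apply: der_fil xk; apply: deg_lt_omonoM.
Qed.

Lemma omono0 : omono 0%MM = 1%:M.
Proof. by rewrite /omono !mnm0E !expr0 mulr1. Qed.

(** The constant matrix X and its conjugate transpose, which is its adjoint,
    both preserve the filtration. *)
Lemma fproj_oact0 X k z : fproj k (oact X 0%MM z) = oact X 0%MM (fproj k z).
Proof.
apply: (@oproj_commute _ _ _ (oact (map_mx Num.conj X)^T 0%MM)).
- by rewrite /oact omono0; apply: der_adj => s t; rewrite kron1_adj.
- by move=> x /(oact_deg X 0%MM); rewrite mdeg0 addn0.
by move=> x /(oact_deg (map_mx Num.conj X)^T 0%MM); rewrite mdeg0 addn0.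
Qed.

Variable D : nat.
Hypothesis D_gt0 : (0 < D)%N.
Hypothesis filD : fil D = M.

Lemma oact_filtered : filtered_action oact fil fproj D.
Proof.
split.
- exact: oact_linear.
- exact: fil0.
- exact: fil_le.
- move=> k Dk; apply/eqP; rewrite eqEsubv (fil_le C n d_gt1 NE Dk) andbT filD.
  exact: fil_ext.
- by move=> k x; apply: oproj_mem.
- by move=> k x; apply: oproj_id.
- by move=> i j x ij; apply/oproj_sub/fil_le.
- exact: oact_deg.
- exact: oact_comm.
Qed.

Let FA := oact_filtered.

Local Notation hact := (hact oact fproj D).
Local Notation gract := (gract oact fproj D).

Definition low_label : label := (i0, 0%MM).

Definition low_labels : {ffun 'I_l -> label} := [ffun=> low_label].

(** This is l! times the wedge of the l vectors v_1 (x) e_(jd+1). *)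
Definition hwvec : Ten := symw B (slots low_labels).

Lemma hwvec_fil1 : hwvec \in fil 1.
Proof.
apply: fil_slots; rewrite ltnS leqn0 /tdeg big1 // => i _.
by rewrite ffunE mdeg0.
Qed.

Lemma hwvec_ext : hwvec \in M.
Proof. by rewrite -filD (subvP (fil_le C n d_gt1 NE D_gt0)) // hwvec_fil1. Qed.

Lemma gpart0_hwvec : gpart fproj 0 hwvec = hwvec.
Proof.
rewrite gpartE [fproj 1 _]oproj_id ?hwvec_fil1 //.
have : fproj 0 hwvec \in fil 0 by apply: oproj_mem.
by rewrite fil0 memv0 => /eqP ->; rewrite subr0.
Qed.

Lemma hact_hwvec G m : hact G m hwvec = gpart fproj (mdeg m) (oact G m hwvec).
Proof. by have := hact_gpart FA G m 0 hwvec; rewrite gpart0_hwvec add0n. Qed.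

(** ** Generation by the highest weight vector *)

Definition excess t := #|[pred i | t i != low_label]|.

Lemma excess_gt0 t : t != low_labels -> exists i, t i != low_label.
Proof.
move=> tl; apply/existsP; rewrite -negb_forall; apply: contraNN tl => /forallP e.
by apply/eqP/ffunP=> i; rewrite ffunE; apply/eqP.
Qed.

Lemma tdeg_upd t i p :
  tdeg (upd t i p) = (mdeg p.2 + \sum_(j | j != i) mdeg (t j).2)%N.
Proof.
rewrite /tdeg (bigD1 i) //= upd_same; congr addn.
by apply: eq_bigr => j ji; rewrite upd_other.
Qed.

Lemma tdeg_split t i :
  tdeg t = (mdeg (t i).2 + \sum_(j | j != i) mdeg (t j).2)%N.
Proof. by rewrite -(tdeg_upd t i) upd_id. Qed.

Lemma slots_swap t i j p : t i = t j ->
  symw B (slots (upd t i p)) = symw B (slots (upd t j p)).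
Proof.
move=> tij; rewrite -(symw_perm B (slots (upd t j p)) (tperm i j)).
congr (symw B _); apply/ffunP=> k; rewrite !ffunE.
have [->|ki] := eqVneq k i; first by rewrite tpermL eqxx.
have [kj|kj] := eqVneq k j; last first.
  by rewrite tpermD ?[i == _]eq_sym ?[j == _]eq_sym // (negPf kj).
by rewrite kj in ki *; rewrite tpermR [i == j]eq_sym (negPf ki) tij.
Qed.

(** A matrix unit serves except when c is the first index, where a traceless
    diagonal matrix is needed; this uses n >= 2. *)
Lemma raise_mx (c : 'I_n) : exists2 X, \tr X = 0 &
  X *m delta_mx i0 0 = delta_mx c 0 :> 'cV[C]_n.
Proof.
have tr_delta i j : \tr (delta_mx i j : 'M[C]_n) = (i == j)%:R.
  rewrite /mxtrace (bigD1 i) //= big1 => [|k ki]; rewrite !mxE.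
    by rewrite eqxx addr0.
  by rewrite (negPf ki).
have [->|ci] := eqVneq c i0.
  exists (delta_mx i0 i0 - delta_mx i1 i1).
    by rewrite linearB /= !tr_delta !eqxx subrr.
  by rewrite mulmxBl mul_delta_mx mul_delta_mx_0 ?subr0.
by exists (delta_mx c i0); rewrite ?tr_delta ?(negPf ci) // mul_delta_mx.
Qed.

(** Polarisation, by induction on the degree and on the excess. To fill slot
    i, apply the operator of its label to the element t' in which slot i is
    reset. The operator acts on every slot: on each reset slot it gives the
    wanted element, by symmetry, and on the other slots it gives combinations
    of elements of smaller excess. *)
Lemma fil_generated (Z : {vspace Ten}) : hwvec \in Z ->
  (forall X m x, \tr X = 0 -> x \in Z -> hact X m x \in Z) ->
  (M <= Z)%VS.
Proof.
move=> hwZ stZ; rewrite -filD.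
suff: forall k, (k <= D)%N -> (fil k <= Z)%VS by apply.
elim=> [|k IHk] kD; first by rewrite fil0 sub0v.
have {}IHk := IHk (ltnW kD).
apply: fil_ind => t; move: {2}(excess t) (leqnn (excess t)) => s.
elim: s t => [|s IHs] t ts tk.
  have [->//|/excess_gt0[i ti]] := eqVneq t low_labels.
  by move: ts; rewrite leqn0 => /eqP/card0_eq/(_ i); rewrite inE ti.
have [->//|/excess_gt0[i ti]] := eqVneq t low_labels.
pose t' := upd t i low_label; pose m := (t i).2.
have t'i : t' i = low_label by rewrite /t' upd_same.
have tE : t = upd t' i (t i) by rewrite /t' upd_upd upd_id.
have wt : tdeg t = (tdeg t' + mdeg m)%N.
  by rewrite (tdeg_split t i) /t' tdeg_upd mdeg0 addnC.
have exc (u : {ffun 'I_l -> label}) :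
    {subset [pred j | u j != low_label] <= [pred j | t' j != low_label]} ->
    (excess u <= s)%N.
  move=> ut'; rewrite -ltnS; apply: leq_trans ts; apply: proper_card.
  apply/properP; split; last first.
    by exists i; rewrite ?inE //; apply/negP=> /ut'; rewrite inE t'i eqxx.
  apply/subsetP=> j /ut'; rewrite !inE /t' updE.
  by case: ifP => // _; rewrite eqxx.
have [X X0 Xi] := raise_mx (t i).1.
have xZ : symw B (slots t') \in Z.
  apply: IHs; first exact: exc.
  by apply: leq_ltn_trans tk; rewrite wt leq_addr.
(* The graded and the filtered action of X (x) m differ by an element of a
   lower step of the filtration, which lies in Z already. *)
have yZ : oact X m (symw B (slots t')) \in Z.
  have xF : symw B (slots t') \in fil (tdeg t').+1 by apply: fil_slots.
  rewrite -[oact _ _ _](subKr (hact X m (symw B (slots t')))).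
  rewrite memvB ?stZ //; apply: (subvP IHk).
  apply: (subvP (fil_le C n d_gt1 NE _)) (hact_lead FA _ _ _ xF).
    by rewrite -wt -ltnS.
  apply: leq_ltn_trans kD; rewrite -ltnS; apply: leq_trans tk.
  by rewrite ltnS wt leq_addr.
have rest j : t' j != low_label -> symw B (upd (slots t') j
    (ten (X *m delta_mx (t' j).1 0)
      (omono m *m (omono (t' j).2 *m weight_mx)))) \in Z.
  move=> tj.
  have zr : ten (X *m delta_mx (t' j).1 0)
        (omono m *m (omono (t' j).2 *m weight_mx))
      \in <<slot_seq C n d_gt1 NE (mdeg (t' j).2 + (mdeg m).+1)>>%VS.
    by apply: ten_slot; apply: deg_lt_omono; apply: wfil_omono.
  apply: (multilinear_span (symw_multilinear B)) zr _.
  move=> _ /slot_seqP[p pm ->]; rewrite slots_upd; apply: IHs.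
    apply: exc => a; rewrite !inE updE; case: (eqVneq a j) => [->|//] _.
    exact: tj.
  apply: leq_ltn_trans tk; rewrite tdeg_upd wt (tdeg_split t' j).
  by rewrite addnAC leq_add2r -ltnS -addnS.
move: yZ; rewrite /oact der_slots (bigID (fun j => t' j == low_label)) /=.
rewrite (eq_bigr (fun=> symw B (slots t))) => [|j /eqP tj]; last first.
  rewrite tj /= omono0 mul1mx Xi {2}tE.
  rewrite (slots_swap (i := i) (j := j)) ?t'i ?tj // -slots_upd.
  by congr (symw B (upd _ _ _)); rewrite /slot.
(* Every reset slot contributes the wanted element; slot i is one of them, so
   the multiplicity is invertible. *)
rewrite sumr_const -scaler_nat.
set q := \sum_(_ | _) _ => yZ.
have qZ : q \in Z by apply: memv_suml => j; apply: rest.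
have c0 : #|[pred j | t' j == low_label]|%:R != 0 :> C.
  by rewrite pnatr_eq0 -lt0n; apply/card_gt0P; exists i; rewrite inE t'i.
by rewrite -[symw B _](scalerK c0) memvZ // -[_ *: _](addrK q) memvB.
Qed.

(** ** The highest weight conditions *)

(** A monomial whose degrees in u and v agree modulo d preserves the isotypic
    component of the e_(jd+1), which are all the e_i with i = 1 modulo d. *)
Lemma omono_weight m : m 0 = m 1 %[mod d] ->
  exists W : 'M[C]_l, omono m *m weight_mx = weight_mx *m W.
Proof.
move=> md; pose w := weight_idx d_gt1 NE.
exists (\matrix_(i, j) omono m (w i) (w j)).
apply/matrixP=> i j; rewrite [LHS]mxE.
rewrite (bigD1 (w j)) //= big1 => [|k kj]; last first.
  by rewrite [weight_mx _ _]mxE (negPf kj) mulr0.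
have wtE a b : weight_mx a b = (a == w b)%:R by rewrite mxE.
have WE k : (\matrix_(i, j) omono m (w i) (w j)) k j = omono m (w k) (w j).
  by rewrite mxE.
rewrite wtE eqxx mulr1 addr0 [RHS]mxE.
have [z|nz] := eqVneq (omono m i (w j)) 0.
  rewrite z big1 // => k _; rewrite wtE WE.
  by case: eqP => [<-|_]; rewrite ?z ?mulr0 // mul0r.
have := omono_shift nz; rewrite /= => e.
have i1d : i %% d = 1 %[mod d].
  rewrite modn_mod; apply/eqP; rewrite -(eqn_modDr (m 1%R)) e -addnA modnMDl.
  by rewrite eqn_modDl; apply/eqP.
have kl : (i %/ d < l)%N.
  have := ltn_ord i; rewrite {2}NE {1}(divn_eq i d) -modn_mod i1d.
  by rewrite (modn_small d_gt1) ltn_add2r mulnC ltn_pmul2l // ltnW.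
have iw : i = w (Ordinal kl).
  apply: ord_inj; rewrite /= {1}(divn_eq i d) -modn_mod i1d.
  by rewrite (modn_small d_gt1).
rewrite (bigD1 (Ordinal kl)) //= big1 => [|k kj].
  by rewrite wtE WE -iw eqxx mul1r addr0.
rewrite wtE; case: eqP => [e'|_]; last by rewrite mul0r.
case/eqP: kj; apply: val_inj; apply/eqP.
have /eqP : val (w (Ordinal kl)) = val (w k) by rewrite -iw e'.
by rewrite /= eqn_add2r eqn_pmul2r 1?eq_sym // ltnW.
Qed.

Lemma slots_low : slots low_labels = [ffun=> slot low_label].
Proof. by apply/ffunP=> i; rewrite !ffunE. Qed.

Lemma wedge_low_fil1 : wedge B (slot low_label) \in fil 1.
Proof.
have f0 : l`!%:R != 0 :> C by rewrite pnatr_eq0 -lt0n fact_gt0.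
rewrite -[wedge _ _](scalerK f0) memvZ // -symw_const -slots_low.
exact: hwvec_fil1.
Qed.

Lemma oact_hwvec G m a : G *m delta_mx i0 0 = a *: (delta_mx i0 0 : 'cV_n) ->
  oact G m hwvec = a *: \sum_i symw B (upd (slots low_labels) i
     (ten (delta_mx i0 0) (omono m *m weight_mx))).
Proof.
move=> Ga; rewrite /oact der_slots scaler_sumr; apply: eq_bigr => i _.
rewrite ffunE /= omono0 mul1mx Ga tenZ.
by rewrite (multilinearZ (symw_multilinear B)).
Qed.

Lemma oact0_hwvec G a : G *m delta_mx i0 0 = a *: (delta_mx i0 0 : 'cV_n) ->
  oact G 0%MM hwvec = (l%:R * a) *: hwvec.
Proof.
move=> Ga; rewrite (oact_hwvec _ Ga) mulrC -scalerA; congr (_ *: _).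
rewrite (eq_bigr (fun=> hwvec)) => [|i _].
  by rewrite sumr_const card_ord scaler_nat.
rewrite -/(slot low_label) slots_upd; congr (symw B (slots _)).
by apply/ffunP=> j; rewrite !ffunE; case: ifP.
Qed.

(** The monomial acts on the isotypic component by an l x l matrix; in a wedge
    of a basis of this component only its diagonal entries survive. *)
Lemma oact_hwvec_fil1 G m a :
  G *m delta_mx i0 0 = a *: (delta_mx i0 0 : 'cV_n) ->
  m 0 = m 1 %[mod d] -> oact G m hwvec \in fil 1.
Proof.
move=> Ga /omono_weight[W WE]; rewrite (oact_hwvec _ Ga) memvZ //.
apply: memv_suml => i _; apply: memv_suml => s _.
set w := slot low_label; pose j : 'I_l := (s^-1)%g i.
set z := ten _ _.
have -> : [ffun k => upd (slots low_labels) i z (s k) k] = upd w j (z j).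
  apply/ffunP=> k; have kj : (k == j) = (s k == i).
    by rewrite -(inj_eq (@perm_inj _ s)) permKV.
  rewrite [LHS]ffunE !updE kj slots_low ffunE.
  by case: eqP => [e|//]; rewrite /j -e permK.
have -> : z j = \sum_k W k j *: w k.
  apply/ffunP=> b; rewrite sum_ffunE /z !ffunE WE mxE scaler_suml.
  by apply: eq_bigr => k _; rewrite !ffunE omono0 mul1mx scalerA mulrC.
rewrite (multilinear_sum (wedge_multilinear B)); apply: memv_suml => k _.
rewrite (multilinearZ (wedge_multilinear B)) memvZ //.
have [->|kj] := eqVneq k j; first by rewrite upd_id wedge_low_fil1.
rewrite ((wedge_alternating l B).2 _ j k) ?mem0v 1?eq_sym //.
by rewrite upd_same upd_other.
Qed.

Lemma hw_upper (X : 'M[A]_n) : (forall i j : 'I_n, (j <= i)%N -> X i j = 0) ->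
  gract X hwvec = 0.
Proof.
move=> Xu; rewrite sum_lfunE big1 // => m _; rewrite hact_hwvec.
rewrite (@oact_hwvec _ _ 0) ?scale0r ?linear0 //.
by apply/colP=> i; rewrite -colE !mxE Xu ?mcoeff0.
Qed.

Lemma diag_mul_delta (h : 'M[C]_n) : is_diag_mx h ->
  h *m delta_mx i0 0 = h i0 i0 *: (delta_mx i0 0 : 'cV_n).
Proof.
move=> /is_diag_mxP hd; apply/colP=> i; rewrite -colE !mxE eqxx andbT.
by case: (eqVneq i i0) => [->|ne]; rewrite ?mulr1 // mulr0 hd.
Qed.

(** Only monomials u^p v^q with p = q modulo d occur in an invariant
    polynomial. Those of positive degree keep hwvec in degree 0, hence have no
    component of the required degree; the constant term acts by l times the
    first diagonal entry. *)
Lemma hw_diag zeta (h : 'M[C]_n) (P : A) : d.-primitive_root zeta ->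
  is_diag_mx h -> cyc_invariant zeta P ->
  gract (tens h P) hwvec = (l%:R * h i0 i0 * P.@[fun=> 0]) *: hwvec.
Proof.
move=> zP /diag_mul_delta hd Pinv; rewrite sum_lfunE.
have E m : hact (map_mx (mcoeff m) (tens h P)) m hwvec =
    P@_m *: gpart fproj (mdeg m) (oact h m hwvec).
  rewrite -hact_hwvec.
  have -> : map_mx (mcoeff m) (tens h P) = P@_m *: h.
    by apply/matrixP=> i j; rewrite !mxE mulr_algr mcoeffZ mulrC.
  have := hact_linear FA m P@_m h 0; rewrite addr0 (hact0 FA) addr0 => ->.
  by rewrite scale_lfunE.
have D0 : (mdeg (0%MM : 'X_{1..2}) < D)%N by rewrite mdeg0.
rewrite (bigD1 (BMultinom D0)) //= E mdeg0 (oact0_hwvec hd).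
rewrite big1 => [|m m0].
  by rewrite addr0 linearZ /= gpart0_hwvec scalerA meval_at0 mulrC.
rewrite E; have [->|Pm] := eqVneq P@_m 0; first by rewrite scale0r.
rewrite (gpart_low FA) ?scaler0 //.
apply: (subvP (fil_le _ _ _ _ _))
  (oact_hwvec_fil1 hd (cyc_invariant_mod zP Pinv Pm)).
by rewrite lt0n mdeg_eq0; apply: contraNneq m0 => e; apply/eqP/val_inj; exact: e.
Qed.

(** ** The graded module *)

Lemma gract_stableM Z : stable M (gract Z).
Proof. by move=> x _; rewrite -filD; apply: (gract_stable FA). Qed.

Definition weyl_act (Z : 'M[A]_n) : 'End(subvs_of M) := restr M (gract Z).

Fact weyl_act_linear (c : C) (Z Z' : 'M[A]_n) : \tr Z = 0 -> \tr Z' = 0 ->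
  weyl_act (c%:A *: Z + Z') = c *: weyl_act Z + weyl_act Z'.
Proof. by move=> _ _; rewrite /weyl_act (gract_linear FA) restr_linear. Qed.

Fact weyl_act_bracket (Z Z' : 'M[A]_n) : \tr Z = 0 -> \tr Z' = 0 ->
  weyl_act (Z *m Z' - Z' *m Z) =
  (weyl_act Z \o weyl_act Z')%VF - (weyl_act Z' \o weyl_act Z)%VF.
Proof.
move=> _ _; rewrite /weyl_act (gract_bracket FA) addrC -scaleN1r restr_linear.
by rewrite scaleN1r addrC !restr_comp //; apply: gract_stableM.
Qed.

Definition weyl_quot : sl_module A n := SlModule weyl_act_linear weyl_act_bracket.

Definition hw : weyl_quot := vsproj M hwvec.

Lemma vsval_hw : vsval hw = hwvec.
Proof. by rewrite vsprojK // hwvec_ext. Qed.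

Lemma weyl_actE Z v : vsval (weyl_act Z v) = gract Z (vsval v).
Proof. by rewrite restrE //; apply: gract_stableM. Qed.

(** The image in the tensor space of a submodule containing the generator is
    all of the exterior power, by fil_generated. *)
Lemma weyl_quot_generated : generated_by hw.
Proof.
move=> W hwW stW; pose iota : 'Hom(subvs_of M, Ten) := linfun vsval.
have iotaE v : iota v = vsval v by rewrite lfunE.
have MW : (M <= iota @: W)%VS.
  apply: fil_generated; first by rewrite -vsval_hw -iotaE memv_img.
  move=> X m _ X0 /memv_imgP[v vW ->].
  rewrite -(gract_tens FA) iotaE -weyl_actE -iotaE memv_img //.
  by apply: (subvP (stW _ (tr_tens _ X0))); apply: memv_img.
apply/eqP; rewrite eqEsubv subvf /=; apply/subvP=> v _.
have /memv_imgP[u uW] := subvP MW _ (subvsP v).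
by rewrite iotaE => /val_inj ->.
Qed.

Lemma weyl_quot_generator zeta : d.-primitive_root zeta ->
  weyl_generator (cyc_invariant zeta)
    (fun h : 'M[C]_n => l%:R * fund_weight 1 h) hw.
Proof.
move=> zP; split; last exact: weyl_quot_generated.
  move=> X Xu; apply: val_inj; rewrite /= -/(weyl_act X hw) weyl_actE vsval_hw.
  by rewrite hw_upper // linear0.
move=> h P hd _ Pinv; apply: val_inj.
rewrite [LHS]weyl_actE vsval_hw (hw_diag zP) //.
rewrite linearZ /= vsval_hw; congr (_ * _ * _ *: _).
by rewrite /fund_weight (bigD1 i0) //= big1 ?addr0 // => -[[|i] ?].
Qed.

(** ** The exterior power as a representation *)

Definition ext_act (X : 'M[C^o]_n) : 'End(subvs_of M) :=
  restr M (der B (kron X 1%:M)).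

Lemma der_stable g : stable M (der B g).
Proof.
move=> x xM; rewrite memv_preim; apply: (subvP (ext_ind _)) xM => u.
by rewrite -memv_preim der_wedge; apply: memv_suml => i _; apply: wedge_ext.
Qed.

Fact ext_act_linear (c : C) (X Y : 'M[C^o]_n) : \tr X = 0 -> \tr Y = 0 ->
  ext_act (c%:A *: X + Y) = c *: ext_act X + ext_act Y.
Proof.
move=> _ _; have -> : c%:A = c :> C^o by exact: mulr1.
by rewrite /ext_act kron_linearl der_linear restr_linear.
Qed.

Fact ext_act_bracket (X Y : 'M[C^o]_n) : \tr X = 0 -> \tr Y = 0 ->
  ext_act (X *m Y - Y *m X) =
  (ext_act X \o ext_act Y)%VF - (ext_act Y \o ext_act X)%VF.
Proof.
move=> _ _; rewrite /ext_act kronBl.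
have -> : kron (X *m Y) 1%:M - kron (Y *m X) 1%:M =
    (kron X 1%:M \o kron Y 1%:M)%VF - (kron Y 1%:M \o kron X 1%:M)%VF
    :> 'End(U).
  by rewrite !kron_comp mulmx1.
rewrite der_comm addrC -scaleN1r restr_linear scaleN1r addrC.
by rewrite !restr_comp //; apply: der_stable.
Qed.

Definition ext_rep : sl_module C^o n := SlModule ext_act_linear ext_act_bracket.

Lemma ext_rep_exterior : exterior_rep l (dsum (nat_rep C n) N) ext_rep.
Proof.
exists (ext_wedge B); split; first exact: ext_exterior_power.
move=> X _ u; apply: val_inj.
rewrite [LHS]restrE; last exact: der_stable.
rewrite vsval_ext_wedge der_wedge linear_sum.
by apply: eq_bigr => i _; rewrite [RHS]vsval_ext_wedge kron1.
Qed.

(** The two modules have the same carrier, and constant matrices act on it in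
    the same way, so the identity map is an isomorphism. *)
Lemma res_weyl_quot : sl_iso (res weyl_quot) ext_rep.
Proof.
exists (\1%VF : 'End(subvs_of M)); split.
- move=> X _ v; rewrite !id_lfunE; apply: val_inj.
  rewrite [LHS]weyl_actE [RHS]restrE; last exact: der_stable.
  have -> : gract (tens X 1) = hact X 0%MM by rewrite -(gract_tens FA) mpolyX0.
  rewrite (hact_const FA) ?filD ?subvsP //; first by rewrite /oact omono0.
  by move=> k z; apply: fproj_oact0.
- by apply/eqP/lker0P => x y; rewrite !id_lfunE.
- exact: lim1g.
Qed.

End WeylQuotient.

(** The graded module of the filtered exterior power, for a filtration that is
    full from some step D.+1 on; the successor makes the number of graded
    parts positive. *)
Lemma weyl_exterior_module (C : numClosedFieldType) (n d l : nat)
    (zeta : C) : (1 < n)%N -> (1 < d)%N -> d.-primitive_root zeta ->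
  exists (Q : sl_module {mpoly C[2]} n) (v : Q),
    weyl_generator (cyc_invariant zeta)
          (fun h : 'M[C]_n => l%:R * fund_weight 1 h) v /\
    exists L : sl_module C^o n,
      exterior_rep l (dsum (nat_rep C n) (d * l + 1)) L /\
      sl_iso (res Q) L.
Proof.
move=> n1 d1 zP; have [D filD] := fil_full C n d1 (erefl (d * l + 1)%N).
have filS : fil C n d1 (erefl (d * l + 1)%N) D.+1 =
    ext l (std_frame C n (d * l + 1)).
  by apply/eqP; rewrite eqEsubv fil_ext -filD fil_le.
exists (weyl_quot filS), (hw n1 filS); split; first exact: weyl_quot_generator.
exists (ext_rep C n l (d * l + 1)); split; first exact: ext_rep_exterior.
exact: res_weyl_quot.
Qed.

Theorem theorem5p19 (R : realType) (n d l : nat)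
  (hn : (2 <= n)%N) (hd : (2 <= d)%N) (hl : (1 <= l)%N)
  (zeta : R[i]) (hzeta : d.-primitive_root zeta)
  (W : sl_module {mpoly R[i][2]} n)
  (hW : is_weyl_module (cyc_invariant zeta)
          (fun h : 'M[R[i]]_n => l%:R * fund_weight 1 h) W) :
  exists Q : sl_module {mpoly R[i][2]} n,
    is_quotient_of Q W /\
    exists L : sl_module (R[i])^o n,
      exterior_rep l (dsum (nat_rep R[i] n) (d * l + 1)) L /\
      sl_iso (res Q) L.
Proof.
have [Q [v [gv isoL]]] := weyl_exterior_module l hn hd hzeta.
by exists Q; split => //; apply: hW.2 gv.
Qed.
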